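(* For every $\alpha>0$ and $k,s,t\in\mathbb{N}$ there exists $C=C(\alpha,k,s,t)>0$ such that the following holds for every $d\in[k-1]$ and every sufficiently large $n$. Let $F$ be a $k$-graph on $s$ vertices with $t$ edges, and let $\mathbf{H}=\{H_1,H_2,\dots,H_{tn}\}$ be a $k$-graph system on $sn$ vertices. If $\delta_d(H_i)\ge(\delta^T_{F,d}+\alpha)\binom{sn-d}{k-d}$ for each $i\in[tn]$, then there is a $(C/n)$-vertex-spread distribution on the embeddings of $F^*$-factors into $\mathcal{H}$.
   Context: For a $k$-graph $H$ and $d\in[k-1]$, $\delta_d(H)$ is the minimum over $d$-subsets $D\subseteq V(H)$ of the number of edges containing $D$. A $k$-graph system $\mathbf{H}=\{H_1,\dots,H_{tn}\}$ is a collection of (not necessarily distinct) $k$-graphs on a common vertex set $V(\mathbf{H})$; its color set is $\mathcal{C}(\mathbf{H})=[tn]$. A transversal $F$-factor in $\mathbf{H}$ is a collection of $n$ vertex-disjoint copies of $F$ covering $V(\mathbf{H})$ whose $tn$ edges can be labelled bijectively by $[tn]$ with the edge labelled $i$ lying in $H_i$. $\delta^T_{F,d}$ is the infimum of $\delta$ such that for all $\alpha>0$ and all large $n$, every $k$-graph system $\{H_1,\dots,H_{tn}\}$ on $sn$ vertices with $\delta_d(H_i)\ge(\delta+\alpha)\binom{sn-d}{k-d}$ for all $i$ contains a transversal $F$-factor. $\mathcal{H}$ is the $(k+1)$-graph with vertex set $V(\mathbf{H})\cup\mathcal{C}(\mathbf{H})$ (disjoint union) in which $\{v_1,\dots,v_k,i\}$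 with $v_j\in V(\mathbf{H})$, $i\in\mathcal{C}(\mathbf{H})$ is an edge iff $\{v_1,\dots,v_k\}\in E(H_i)$. The expansion $F^*$ of $F$ is the $(k+1)$-graph on $s+t$ vertices obtained from $F$ by adding to each edge a new vertex, distinct edges receiving distinct new vertices. An $F^*$-factor is the $(k+1)$-graph consisting of $n$ vertex-disjoint copies of $F^*$ (on $(s+t)n$ vertices). An embedding $\varphi:G\hookrightarrow\mathcal{H}$ is an injection $V(G)\to V(\mathcal{H})$ mapping edges to edges. For $q\in[0,1]$, a distribution $\mu$ on embeddings $G\hookrightarrow\mathcal{H}$ is $q$-vertex-spread if for every two sequences of distinct vertices $x_1,\dots,x_r\in V(G)$ and distinct $y_1,\dots,y_r\in V(\mathcal{H})$, $\mu(\{\varphi:\varphi(x_i)=y_i\ \forall i\in[r]\})\le q^r$. *)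

(* Defs.v *)
From HB Require Import structures.
From mathcomp Require Import all_boot all_order all_algebra.
From mathcomp Require Import reals.

Set Implicit Arguments.
Unset Strict Implicit.
Unset Printing Implicit Defensive.

Import Order.TTheory GRing.Theory Num.Theory.
Local Open Scope ring_scope.

(* A hypergraph on the vertex set [V] (a finite type, so that isolated
   vertices are accounted for) is its edge set, of type [{set {set V}}]. *)

Definition kgraph (k : nat) (V : finType) (E : {set {set V}}) : Prop :=
  forall e : {set V}, e \in E -> #|e| = k.

Definition degree (V : finType) (E : {set {set V}}) (D : {set V}) : nat :=
  #|[pred e | (e \in E) && (D \subset e)]|.

(* Every degree is at most [#|E|], so the default value [#|E|] of the iterated
   minimum plays no role as soon as [V] has a subset of size [d]. *)
Definition min_degree (d : nat) (V : finType) (E : {set {set V}}) : nat :=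
  \big[minn/#|E|]_(D : {set V} | #|D| == d) degree E D.

Definition kgraph_system (k m : nat) (V : finType)
    (H : 'I_m -> {set {set V}}) : Prop :=
  forall i, kgraph k (H i).

Definition edge_of (V : finType) (E : {set {set V}}) : finType :=
  {e : {set V} | e \in E}.

(* The j-th copy of [F] is the image of [fun v => phi (j, v)].  Injectivity of
   [phi] says that each of these maps is injective and that the copies are
   vertex-disjoint; surjectivity says that they cover [V].  The edges of the
   copies are indexed by pairs (copy, edge of [F]). *)
Definition has_transversal_factor (VF : finType) (F : {set {set VF}})
    (n m : nat) (V : finType) (H : 'I_m -> {set {set V}}) : Prop :=
  exists phi : 'I_n * VF -> V, bijective phi /\
  exists lam : 'I_n * edge_of F -> 'I_m, bijective lam /\
    forall (j : 'I_n) (e : edge_of F),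
      [set phi (j, v) | v in val e]%SET \in H (lam (j, e)).

Definition is_transversal_threshold (R : realType) (k d : nat) (VF : finType)
    (F : {set {set VF}}) (delta : R) : Prop :=
  forall a : R, 0 < a ->
  exists n0 : nat, forall n : nat, (n0 <= n)%N ->
  forall (V : finType) (H : 'I_(#|F| * n) -> {set {set V}}),
    #|V| = (#|VF| * n)%N ->
    kgraph_system k H ->
    (forall i, (delta + a) * 'C(#|VF| * n - d, k - d)%:R
               <= (min_degree d (H i))%:R) ->
    has_transversal_factor F n H.

Definition deltaT (R : realType) (k d : nat) (VF : finType)
    (F : {set {set VF}}) : R :=
  inf (@is_transversal_threshold R k d VF F).

Definition system_hypergraph (m : nat) (V : finType)
    (H : 'I_m -> {set {set V}}) : {set {set (V + 'I_m)}} :=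
  [set inr i |: (inl @: e) | i : 'I_m, e : {set V} in H i]%SET.

(* The new vertex added to the edge [e] is [inr e]. *)
Definition expansion (V : finType) (E : {set {set V}}) :
    {set {set (V + edge_of E)}} :=
  [set inr e |: (inl @: val e) | e : edge_of E]%SET.

(* The factor consisting of [n] vertex-disjoint copies of [G]. *)
Definition factor (n : nat) (W : finType) (G : {set {set W}}) :
    {set {set ('I_n * W)}} :=
  [set [set (j, w) | w in e] | j : 'I_n, e : {set W} in G]%SET.

Definition is_embedding (W U : finType) (G : {set {set W}})
    (K : {set {set U}}) (phi : {ffun W -> U}) : bool :=
  injectiveb phi && [forall e in G, (phi @: e)%SET \in K].

Definition embedding (W U : finType) (G : {set {set W}}) (K : {set {set U}}) :
    finType :=
  {phi : {ffun W -> U} | is_embedding G K phi}.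

Definition distribution (R : realType) (T : finType) (mu : T -> R) : Prop :=
  (forall x, 0 <= mu x) /\ \sum_x mu x = 1.

Definition vertex_spread (R : realType) (W U : finType) (G : {set {set W}})
    (K : {set {set U}}) (q : R) (mu : embedding G K -> R) : Prop :=
  0 <= q <= 1 /\
  forall (r : nat) (x : 'I_r -> W) (y : 'I_r -> U),
    injective x -> injective y ->
    \sum_(phi : embedding G K | [forall i, val phi (x i) == y i]) mu phi
      <= q ^+ r.

(* Main.v *)
Require Import Defs.
From mathcomp Require Import all_boot all_order all_algebra perm.
From mathcomp Require Import ring lra zify.
From mathcomp Require Import boolp reals sequences exp.

(* Cut the copies of F^* into blocks of bounded size and take a random injection
   of the positions (vertices and edges of the copies) into vertices and colours,
   conditioned on every block receiving a set of vertices and colours that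
   inherits the minimum degree condition.  A block of bounded size that inherits
   it contains a transversal factor, by the definition of the threshold, and
   choosing one in every block gives the random embedding; it maps a given
   position to a given target only if the target lies in the image of the block
   of this position, so its spread is that of the conditioned injection, up to a
   constant.  A block is bad with probability exponentially small in its size:
   the degrees in a random set are U-statistics, which are averages of sums of
   independent variables over disjoint tuples.  The conditioning is handled by
   the lopsided local lemma for random injections, which changes the probability
   of prescribing [r] values by a factor of at most [4 ^ r]. *)

Import Order.TTheory GRing.Theory Num.Theory.
Local Open Scope ring_scope.

Set Implicit Arguments.
Unset Strict Implicit.
Unset Printing Implicit Defensive.

(** * The lopsided local lemma *)

(** Blocks of bounded size fail with constant probability, so a union bound over all blocks is
    hopeless and a local lemma is needed. Random injections are not product measures, but
    transposing two values shows that avoiding unrelated block images can only lower the probability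
    of a prescription, which is all that the lopsided version asks for. Its events are pairs (block,
    image); too many of them meet a given one for a degree condition, but their total probability
    per block and per value is small. For a value [u], this total concerns a bad block that contains
    [u], so badness has to be estimated given [f x = u]. The constant is [4 * e * Q], up to an
    additive 1, with [Q] bounding the block size: [e] comes from replacing falling factorials by
    powers, and [Q] counts the positions of a block that may take a prescribed target. It must be
    fixed before [d] and [F], which is possible because up to isomorphism there are finitely many
    pairs [(d, F)]. Large blocks are rarely bad because a block has polynomially many pairs of a
    colour and a [d]-set, against an exponential tail for each. *)

Lemma card_bigcup_le (I T : finType) (P : pred I) (A : I -> {set T}) :
  (#|\bigcup_(i | P i) A i| <= \sum_(i | P i) #|A i|)%N.
Proof.
elim/big_rec2: _ => [|i B m _ leBm]; first by rewrite cards0.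
by apply: (leq_trans (leq_card_setU _ _).1); rewrite leq_add2l.
Qed.

(* Two events are neighbours in the dependency graph when they share a token;
   the weight of the events carrying a given token replaces the usual weight of
   a neighbourhood. *)
Section LocalLemma.
Variables (R : realFieldType) (Om I K : finType) (O : {set Om}).
Variables (E : I -> {set Om}) (tok : I -> {set K}) (p : I -> R).

Definition avoid (S : {set I}) : {set Om} :=
  [set w in O | [forall i in S, w \notin E i]].

Lemma avoidP (S : {set I}) w :
  reflect (w \in O /\ forall i, i \in S -> w \notin E i) (w \in avoid S).
Proof.
rewrite inE; apply: (iffP andP) => -[wO h]; split=> //.
  by move=> i iS; move/forall_inP: h; apply.
by apply/forall_inP.
Qed.

Lemma avoid0 : avoid set0 = O.
Proof. by apply/setP => w; apply/avoidP/idP => [[]|] //; split=> // i; rewrite inE. Qed.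

Lemma avoidS (S S' : {set I}) : S \subset S' -> avoid S' \subset avoid S.
Proof.
move=> /subsetP sS; apply/subsetP => w /avoidP[wO h]; apply/avoidP.
by split=> // i /sS /h.
Qed.

Lemma avoidU_ge (S S' : {set I}) :
  #|avoid S|%:R - \sum_(i in S') #|E i :&: avoid S|%:R
    <= #|avoid (S :|: S')|%:R :> R.
Proof.
rewrite lerBlDr -natr_sum -natrD ler_nat.
have sub : avoid S \subset
    avoid (S :|: S') :|: \bigcup_(i in S') (E i :&: avoid S).
  apply/subsetP => w wS; rewrite inE; case: (boolP (w \in _)) => //= wN.
  have /avoidP[wO wE] := wS.
  have [i iS' wi] : exists2 i, i \in S' & w \in E i.
    apply/exists_inP; apply: contraR wN; rewrite negb_exists_in => /forall_inP h.
    by apply/avoidP; split=> // i; rewrite inE => /orP[/wE|/h].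
  by apply/bigcupP; exists i => //; rewrite inE wi.
apply: (leq_trans (subset_leq_card sub)); apply: (leq_trans (leq_card_setU _ _).1).
rewrite leq_add2l; exact: card_bigcup_le.
Qed.

Variables (B : {set I}) (eps : R) (M : nat).
Hypothesis p_ge0 : forall i, 0 <= p i.
Hypothesis lopsided : forall i (S : {set I}), i \in B ->
  {in S, forall i', [disjoint tok i & tok i']} ->
  #|E i :&: avoid S|%:R <= p i * #|avoid S|%:R.
Hypothesis few_tokens : forall i, i \in B -> (#|tok i| <= M)%N.
Hypothesis token_weight : forall c, \sum_(i in B | c \in tok i) p i <= eps.
Hypothesis M_eps : M.+1%:R * eps <= 4^-1.

Lemma eps_ge0 (c : K) : 0 <= eps.
Proof. by apply: le_trans (token_weight c); apply: sumr_ge0. Qed.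

(** Induction on the size of [S], split into the neighbours [S1] of [i] and the rest [S2].
    Lopsidedness bounds the left side by [p i] times the size of [avoid S2], and going back to
    [avoid S] loses at most half: by induction each event of [S1] takes a share of at most
    [2 * p i'], and the tokens of [i] limit the weight of [S1] to 1/4. *)
Lemma local_lemma_event (S : {set I}) i : S \subset B -> i \in B ->
  #|E i :&: avoid S|%:R <= 2 * p i * #|avoid S|%:R.
Proof.
have [n] := ubnP #|S|; elim: n S i => // n IHn S i /ltnSE leS SB iB.
pose S1 := [set i' in S | ~~ [disjoint tok i & tok i']].
pose S2 := S :\: S1.
have S12 : S2 :|: S1 = S.
  apply/setP => i'; rewrite !inE; case: (i' \in S) => //=.
  by case: [disjoint _ & _].
have S2S : S2 \subset S by rewrite subsetDl.
have indep : #|E i :&: avoid S|%:R <= p i * #|avoid S2|%:R.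
  have le2 : {in S2, forall i', [disjoint tok i & tok i']}.
    by move=> i'; rewrite !inE => /andP[h iS]; move: h; rewrite iS /= negbK.
  apply: (le_trans _ (lopsided iB le2)); rewrite ler_nat.
  by apply/subset_leq_card/setIS/avoidS.
(* Without neighbours [S2] is [S] itself, too large for the induction hypothesis, but then [indep]
   is enough. *)
have [S1_0|/set0Pn[i1 i1S]] := eqVneq S1 set0.
  apply: (le_trans indep); rewrite /S2 S1_0 setD0 -mulrA ler_peMl ?mulr_ge0 //.
  by rewrite ler1n.
have half : 2^-1 * #|avoid S2|%:R <= #|avoid S|%:R :> R.
  rewrite -S12; apply: le_trans (avoidU_ge _ _).
  have ltS : (#|S2| < n)%N.
    apply: leq_trans leS; apply: proper_card; apply/properP; split=> //.
    by exists i1; [move: i1S; rewrite inE => /andP[] | rewrite in_setD i1S].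
  have sub : \sum_(i' in S1) #|E i' :&: avoid S2|%:R
      <= \sum_(i' in S1) 2 * p i' * #|avoid S2|%:R :> R.
    apply: ler_sum => i' i'S1; apply: IHn => //.
      exact: subset_trans SB.
    by apply: (subsetP SB); move: i'S1; rewrite inE => /andP[].
  have weight : \sum_(i' in S1) p i' <= 4^-1.
    (* Each neighbour shares at least one token with [i], so the double sum counts it. *)
    apply: (@le_trans _ _ (\sum_(c in tok i) \sum_(i' in B | c \in tok i') p i')).
      under [leRHS]eq_bigr do rewrite big_mkcondr.
      rewrite exchange_big /= [leLHS]big_mkcond [leRHS]big_mkcond.
      apply: ler_sum => i' _ /=; rewrite inE; case: ifP => [/andP[i'S]|_].
        rewrite (subsetP SB _ i'S) => /pred0Pn[c /andP[/= ci ci']].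
        by rewrite (bigD1 c) //= ci' lerDl sumr_ge0 // => c' _; case: ifP.
      by case: ifP => // _; apply: sumr_ge0 => c' _; case: ifP.
    apply: (le_trans (ler_sum _ (fun c _ => token_weight c))).
    rewrite sumr_const; apply: le_trans M_eps.
    have [c _] : exists c, c \in tok i.
      move: i1S; rewrite inE => /andP[_]; rewrite -setI_eq0 => /set0Pn[c].
      by rewrite inE => /andP[ci _]; exists c.
    rewrite -(mulr_natl eps) ler_wpM2r ?(eps_ge0 c) // ler_nat.
    exact: leq_trans (few_tokens iB) _.
  rewrite -mulr_suml -mulr_sumr in sub.
  have A0 : 0 <= #|avoid S2|%:R :> R by [].
  have : (\sum_(i' in S1) p i') * #|avoid S2|%:R <= 4^-1 * #|avoid S2|%:R.
    by rewrite ler_wpM2r.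
  lra.
by have := ler_wpM2l (p_ge0 i) half; lra.
Qed.

(** By [local_lemma_event], the events carrying one token remove a share of at most [2 * eps], hence
    at most half. *)
Lemma local_lemma_token (S : {set I}) c : S \subset B ->
  #|avoid S|%:R <= 2 * #|avoid (S :|: [set i in B | c \in tok i])|%:R :> R.
Proof.
move=> SB; have := avoidU_ge S [set i in B | c \in tok i].
have : \sum_(i in [set i in B | c \in tok i]) #|E i :&: avoid S|%:R
    <= 2 * eps * #|avoid S|%:R.
  apply: (@le_trans _ _ (\sum_(i in B | c \in tok i) 2 * p i * #|avoid S|%:R)).
    rewrite (eq_bigl (fun i => (i \in B) && (c \in tok i))); last first.
      by move=> i; rewrite inE.
    by apply: ler_sum => i /andP[iB _]; apply: local_lemma_event.
  by rewrite -mulr_suml -mulr_sumr ler_wpM2r // ler_wpM2l.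
have e4 : eps <= 4^-1.
  apply: le_trans M_eps; rewrite ler_peMl ?(eps_ge0 c) //.
  by rewrite ler1n.
have A0 : 0 <= #|avoid S|%:R :> R by [].
have : eps * #|avoid S|%:R <= 4^-1 * #|avoid S|%:R by rewrite ler_wpM2r.
lra.
Qed.

(** The events are imposed again one token at a time. Lopsidedness only controls events away from a
    prescription; this gives the price of the others. *)
Lemma local_lemma_tokens (cs : seq K) :
  #|avoid [set i in B | [disjoint tok i & cs]]|%:R
    <= 2 ^+ size cs * #|avoid B|%:R :> R.
Proof.
elim: cs => [|c cs IHcs].
  rewrite expr0 mul1r ler_nat; apply/subset_leq_card/avoidS/subsetP => i iB.
  by rewrite inE iB /=; apply/pred0P => x /=; rewrite in_nil andbF.
rewrite exprS -mulrA; apply: (@le_trans _ _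
  (2 * #|avoid [set i in B | [disjoint tok i & cs]]|%:R)); last first.
  by rewrite ler_wpM2l.
set S := [set i in B | [disjoint tok i & c :: cs]].
have SB : S \subset B by apply/subsetP => i; rewrite inE => /andP[].
apply: (le_trans (local_lemma_token c SB)); rewrite ler_wpM2l // ler_nat.
apply/subset_leq_card/avoidS/subsetP => i; rewrite !inE => /andP[iB] dis.
rewrite iB /= disjoint_sym disjoint_cons disjoint_sym dis andbT.
by case: (c \in tok i).
Qed.

(** If [cs] meets every event, the left side of [local_lemma_tokens] carries no condition and is the
    size of [O]. *)
Lemma local_lemma_gt0 (cs : seq K) : (0 < #|O|)%N ->
  (forall i, i \in B -> ~~ [disjoint tok i & cs]) -> (0 < #|avoid B|)%N.
Proof.
move=> O0 hB; have := local_lemma_tokens cs.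
rewrite (_ : [set i in B | _] = set0) ?avoid0; last first.
  by apply/setP => i; rewrite !inE; apply/negP => /andP[/hB/negP].
move=> h; rewrite lt0n; apply: contraTneq O0 => A0; move: h.
by rewrite A0 mulr0 -leqNgt (_ : 0 = 0%:R) // ler_nat.
Qed.

End LocalLemma.

Arguments avoidP {Om I O E S w}.

(** * Random injections preserving sorts *)

Section SortedInjections.
Variables (W U K J : finType) (cW : W -> K) (cU : U -> K) (b : W -> J).

Definition sinj : {set {ffun W -> U}} :=
  [set f : {ffun W -> U} | injectiveb f && [forall w, cU (f w) == cW w]].

Definition block (j : J) : {set W} := [set w | b w == j].

Definition covers (i : J * {set U}) : {set {ffun W -> U}} :=
  [set f : {ffun W -> U} | f @: block i.1 == i.2].

Definition ext (g : seq (W * U)) : {set {ffun W -> U}} :=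
  [set f : {ffun W -> U} | all (fun p => f p.1 == p.2) g].

Definition free (g : seq (W * U)) (c : K) : {set U} :=
  [set z | (cU z == c) && (z \notin unzip2 g)].

(** The inverse probability of a consistent prescription [g] under a uniform sorted injection: pairs
    are prescribed from the tail up, and each new value is one of the free values of its sort. *)
Fixpoint ext_weight (g : seq (W * U)) : nat :=
  if g is p :: g' then (#|free g' (cU p.2)| * ext_weight g')%N else 1%N.

(** In terms of the dependency graph, [g] touches no token of an event of [S]. *)
Definition apart (S : {set J * {set U}}) (g : seq (W * U)) : bool :=
  [forall i in S, all (fun p => (b p.1 != i.1) && (p.2 \notin i.2)) g].

Lemma sinjP (f : {ffun W -> U}) :
  reflect (injective f /\ forall w, cU (f w) = cW w) (f \in sinj).
Proof.
rewrite inE; apply: (iffP andP) => -[fI fc]; split.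
- by apply/injectiveP.
- by move=> w; apply/eqP; move/forallP: fc.
- by apply/injectiveP.
- by apply/forallP => w; apply/eqP.
Qed.

Definition swap (y z : U) (f : {ffun W -> U}) : {ffun W -> U} :=
  [ffun w => tperm y z (f w)].

Lemma swapK y z : involutive (swap y z).
Proof. by move=> f; apply/ffunP => w; rewrite !ffunE tpermK. Qed.

Lemma swap_sinj y z f : cU y = cU z -> f \in sinj -> swap y z f \in sinj.
Proof.
move=> cyz /sinjP[fI fc]; apply/sinjP; split=> [w w'|w].
  by rewrite !ffunE => /perm_inj /fI.
by rewrite ffunE -fc; case: tpermP => [->|->|].
Qed.

Lemma swap_ext g y z f : y \notin unzip2 g -> z \notin unzip2 g ->
  f \in ext g -> swap y z f \in ext g.
Proof.
rewrite !inE => yg zg /allP fg; apply/allP => p pg.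
rewrite ffunE (eqP (fg _ pg)); apply/eqP/tpermD.
  by apply: contraNneq yg => ->; apply: map_f.
by apply: contraNneq zg => ->; apply: map_f.
Qed.

(* Transposing the value [y] taken at [x] with any free value [z] of its sort
   cannot create a forbidden block image: such an image would avoid both [y]
   and [z], so it was already there before the transposition. *)
Lemma ext_step_le (S : {set J * {set U}}) g x y :
  y \notin unzip2 g -> apart S [:: (x, y)] ->
  (#|ext ((x, y) :: g) :&: avoid sinj covers S| * #|free g (cU y)|
     <= #|ext g :&: avoid sinj covers S|)%N.
Proof.
move=> yg /forall_inP apS; rewrite -cardsX.
rewrite -(@card_in_imset _ _ (fun q => swap y q.2 q.1)).
  apply/subset_leq_card/subsetP => _ /imsetP[[f z] + ->] /=.
  rewrite in_setX /= => /andP[/setIP[fg /avoidP[fO fS]]].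
  rewrite inE => /andP[/eqP cz zg].
  move: fg; rewrite inE /= => /andP[/eqP fx fg].
  have {}fg : f \in ext g by rewrite inE.
  rewrite in_setI swap_ext //; apply/avoidP; split.
    by rewrite swap_sinj.
  move=> i iS; apply/negP; rewrite inE => /eqP fi; move/negP: (fS i iS); apply.
  have /= := apS i iS; rewrite andbT => /andP[bx yi].
  have zi : z \notin i.2.
    apply/negP; rewrite -fi => /imsetP[w]; rewrite inE => /eqP bw.
    rewrite ffunE => /(congr1 (tperm y z)); rewrite tpermK tpermR -fx.
    by case/sinjP: fO => fI _ /fI xw; rewrite xw bw eqxx in bx.
  rewrite inE -[f](swapK y z) -[X in _ == X](_ : tperm y z @: i.2 = _).
    apply/eqP; rewrite -fi -imset_comp; apply: eq_imset => w /=.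
    by rewrite !ffunE.
  rewrite -[RHS]imset_id; apply: eq_in_imset => u ui.
  by apply: tpermD; apply: contraTneq ui => <-.
move=> [f z] [f' z']; rewrite !inE /= => /andP[/andP[/andP[/eqP fx _] _] _].
case/andP=> /andP[/andP[/eqP fx' _] _] _ eqf.
have eqz : z = z'.
  have := congr1 (fun h : {ffun W -> U} => h x) eqf.
  by rewrite !ffunE fx fx' !tpermL.
by rewrite -eqz in eqf *; rewrite -(swapK y z f) eqf swapK.
Qed.

(** The switching run backwards: exchanging the value at [x] with [y] enforces the new pair, and
    remembering the old value [f x], which is free, makes the exchange invertible. *)
Lemma ext_step_ge g x y :
  x \notin unzip1 g -> y \notin unzip2 g -> cU y = cW x ->
  (#|ext g :&: sinj| <= #|ext ((x, y) :: g) :&: sinj| * #|free g (cU y)|)%N.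
Proof.
move=> xg yg cxy; rewrite -cardsX.
rewrite -(@card_in_imset _ _ (fun f : {ffun W -> U} => (swap y (f x) f, f x))).
  apply/subset_leq_card/subsetP => _ /imsetP[f /setIP[fg fO] ->].
  have /sinjP[fI fc] := fO.
  have fxg : f x \notin unzip2 g.
    apply/negP => /mapP[p pg fxp]; move: fg; rewrite inE => /allP/(_ p pg).
    rewrite -fxp => /eqP/fI px; move/negP: xg; apply; rewrite -px.
    exact: map_f.
  rewrite inE /= inE swap_sinj ?fc // andbT !inE /= fc cxy eqxx fxg andbT.
  rewrite ffunE tpermR eqxx /=.
  by have := swap_ext yg fxg fg; rewrite inE andbT.
move=> h h' _ _ [] + eqx; rewrite -eqx => eqh.
by rewrite -(swapK y (h x) h) eqh swapK.
Qed.

Lemma avoid_sinj S : avoid sinj covers S \subset sinj.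
Proof. by apply/subsetP => f /avoidP[]. Qed.

(** Iterates [ext_step_le]. With [S] empty it is the converse of [ext_sinj_ge], so the weight is
    exact; for other [S] the same bound survives the conditioning. *)
Lemma ext_avoid_le (S : {set J * {set U}}) g :
  uniq (unzip2 g) -> apart S g ->
  (#|ext g :&: avoid sinj covers S| * ext_weight g <= #|avoid sinj covers S|)%N.
Proof.
elim: g => [|[x y] g IHg] /=; first by rewrite muln1 subset_leq_card ?subsetIr.
move=> /andP[yg ug] /forall_inP apS; rewrite mulnA.
have ap1 : apart S [:: (x, y)].
  by apply/forall_inP => i /apS /= /andP[-> _].
have apg : apart S g by apply/forall_inP => i /apS /= /andP[].
apply: leq_trans (IHg ug apg); rewrite leq_mul2r ext_step_le ?orbT //.
Qed.

Lemma ext_sinj_ge g :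
  uniq (unzip1 g) -> uniq (unzip2 g) -> all (fun p => cU p.2 == cW p.1) g ->
  (#|sinj| <= #|ext g :&: sinj| * ext_weight g)%N.
Proof.
elim: g => [|[x y] g IHg] /=.
  rewrite muln1 => _ _ _; apply/subset_leq_card/subsetP => f fO.
  by rewrite in_setI fO inE.
move=> /andP[xg u1] /andP[yg u2] /andP[/eqP cxy cg]; rewrite mulnA.
by apply: leq_trans (IHg u1 u2 cg) _; rewrite leq_mul2r ext_step_ge ?orbT.
Qed.

Lemma ext_valid g f : uniq (unzip1 g) -> f \in ext g -> f \in sinj ->
  uniq (unzip2 g) /\ all (fun p => cU p.2 == cW p.1) g.
Proof.
move=> ug; rewrite inE => /allP fg /sinjP[fI fc]; split; last first.
  by apply/allP => p pg; rewrite -(eqP (fg p pg)) fc.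
rewrite (_ : unzip2 g = map f (unzip1 g)) ?(map_inj_uniq fI) //.
rewrite -map_comp; apply/eq_in_map => p pg /=.
by rewrite (eqP (fg p pg)).
Qed.

(** Both ratios are compared with the inverse of [ext_weight cU g], which cancels. Consistency of
    [g] is automatic: if the left side is non-zero, some sorted injection extends [g]. *)
Lemma ext_lopsided (S : {set J * {set U}}) g : uniq (unzip1 g) -> apart S g ->
  (#|ext g :&: avoid sinj covers S| * #|sinj|
     <= #|ext g :&: sinj| * #|avoid sinj covers S|)%N.
Proof.
move=> ug apg.
have [e0|/set0Pn[f /setIP[fg /(subsetP (avoid_sinj S)) fO]]] :=
    eqVneq (ext g :&: avoid sinj covers S) set0; first by rewrite e0 cards0.
have [u2 cg] := ext_valid ug fg fO.
apply: leq_trans (_ : #|ext g :&: avoid sinj covers S| *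
    (#|ext g :&: sinj| * ext_weight g) <= _)%N.
  by rewrite leq_mul2l ext_sinj_ge ?orbT.
by rewrite mulnCA leq_mul2l ext_avoid_le ?orbT.
Qed.

Lemma ext_zip (s : seq W) (t : seq U) f : size s = size t ->
  (f \in ext (zip s t)) = (map f s == t).
Proof.
rewrite inE; elim: s t => [|x s IHs] [|y t] //= [st].
by rewrite IHs // eqseq_cons.
Qed.

Lemma card_values (s : seq W) n (A : {set {ffun W -> U}}) : size s = n ->
  #|A| = (\sum_(t : n.-tuple U) #|ext (zip s t) :&: A|)%N.
Proof.
move=> sn; rewrite -sum1_card.
have szP (f : {ffun W -> U}) : size (map f s) == n by rewrite size_map sn.
pose h (f : {ffun W -> U}) : n.-tuple U := Tuple (szP f).
rewrite (partition_big h predT) //=; apply: eq_bigr => t _.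
rewrite -sum1_card; apply: eq_bigl => f; rewrite inE andbC; congr (_ && _).
by rewrite ext_zip ?size_tuple // -val_eqE.
Qed.

(** That a block has image [T] is a disjoint union of prescriptions, one for each way to enumerate
    [T] along the block. Each of them is apart from [S], and [ext_lopsided] is summed over them. *)
Lemma covers_lopsided (S : {set J * {set U}}) (i : J * {set U}) :
  (forall i', i' \in S -> (i.1 != i'.1) && [disjoint i.2 & i'.2]) ->
  (#|covers i :&: avoid sinj covers S| * #|sinj|
     <= #|covers i :&: sinj| * #|avoid sinj covers S|)%N.
Proof.
case: i => j T /= apS; pose s := enum (block j).
rewrite (@card_values s (size s)) // (@card_values s (size s) (_ :&: sinj)) //.
rewrite !big_distrl /=; apply: leq_sum => t _.
have sz : size s = size t by rewrite size_tuple.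
have z1 : unzip1 (zip s t) = s by apply/unzip1_zip/eq_leq.
have z2 : unzip2 (zip s t) = t by apply/unzip2_zip/eq_leq.
have image f : f \in ext (zip s t) -> f @: block j = [set u in t].
  rewrite ext_zip // => /eqP ft; apply/setP => u; rewrite inE.
  have -> : (u \in t) = (u \in map f s) by rewrite ft.
  apply/imsetP/mapP => -[w ws ->]; exists w => //.
    by rewrite mem_enum.
  by rewrite -mem_enum.
have [tT|tT] := eqVneq [set u in t] T; last first.
  suff -> : ext (zip s t) :&: (covers (j, T) :&: avoid sinj covers S) = set0.
    by rewrite cards0.
  apply/setP => f; rewrite in_set0 !in_setI; apply/negP => /and3P[fe].
  by rewrite inE image // (negPf tT).
have sub A : ext (zip s t) :&: (covers (j, T) :&: A) = ext (zip s t) :&: A.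
  apply/setP => f; rewrite !in_setI; case: (boolP (f \in ext _)) => //= fe.
  by rewrite inE image //= tT eqxx.
rewrite !sub; apply: ext_lopsided.
  by rewrite z1; apply: enum_uniq.
apply/forall_inP => i' i'S; apply/allP => -[x y] xy /=.
have /andP[ne dis] := apS i' i'S.
have xs : x \in s by rewrite -z1; apply: (map_f fst xy).
have yt : y \in tval t by rewrite -z2; apply: (map_f snd xy).
move: xs; rewrite mem_enum inE => /eqP->; rewrite ne /=.
have yT : y \in T by rewrite -tT inE.
by rewrite (disjointFr dis).
Qed.

End SortedInjections.

(** * Injections without bad blocks *)

Section GoodInjections.
Variables (R : realFieldType) (W U K J : finType).
Variables (cW : W -> K) (cU : U -> K) (b : W -> J).
Variables (bad : J -> {set U} -> bool) (M : nat) (eps : R).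

Let O := sinj cW cU.
Let img (f : {ffun W -> U}) (j : J) : {set U} := f @: block b j.

Definition good_sinj : {set {ffun W -> U}} :=
  [set f in O | [forall j, ~~ bad j (f @: block b j)]].

Hypothesis block_le : forall j, (#|block b j| <= M)%N.
Hypothesis M_eps : M.+2%:R * eps <= 4^-1.
Hypothesis bad_block : forall j,
  #|[set f in O | bad j (img f j)]|%:R <= eps * #|O|%:R.
Hypothesis bad_vertex : forall u,
  \sum_j #|[set f in O | bad j (img f j) && (u \in img f j)]|%:R
    <= eps * #|O|%:R.
Hypothesis O_gt0 : (0 < #|O|)%N.

(** The images of blocks have at most [M] elements, so the size condition excludes no actual image;
    it bounds the number of tokens of an event. *)
Let B : {set J * {set U}} := [set i | bad i.1 i.2 && (#|i.2| <= M)%N].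
(* The tokens of the event that block [j] has image [T] are [j] and the elements
   of [T]. *)
Let tok (i : J * {set U}) : {set J + U} := inl i.1 |: (inr @: i.2).
Let p (i : J * {set U}) : R := #|covers b i :&: O|%:R / #|O|%:R.

Lemma in_tokl j i : (inl j \in tok i) = (j == i.1).
Proof.
rewrite !inE; have [->|ji] := eqVneq j i.1; first by rewrite eqxx.
apply/negP => /orP[/eqP[/eqP]|/imsetP[] //]; exact/negP.
Qed.

Lemma in_tokr u i : (inr u \in tok i) = (u \in i.2).
Proof.
by rewrite !inE /= mem_imset // => v w [].
Qed.

Lemma avoid_bad : avoid O (covers b) B = good_sinj.
Proof.
apply/setP => f; apply/avoidP/idP => [[fO fB]|].
  rewrite inE fO; apply/forallP => j; apply/negP => bj.
  have /fB : (j, f @: block b j) \in B.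
    by rewrite inE bj (leq_trans (leq_imset_card _ _)).
  by rewrite inE eqxx.
rewrite inE => /andP[fO /forallP fG]; split=> // i; rewrite !inE => /andP[bi _].
by apply: contraL bi => /eqP <-.
Qed.

Lemma sum_covers j (P : pred {set U}) :
  (\sum_(T | P T) #|covers b (j, T) :&: O| = #|[set f in O | P (img f j)]|)%N.
Proof.
rewrite -sum1_card (partition_big (fun f : {ffun W -> U} => img f j) P) /=.
  apply: eq_bigr => T PT; rewrite -sum1_card; apply: eq_bigl => f.
  rewrite !inE /img /=; case: eqP => [->|]; last by rewrite andbF.
  by rewrite PT !andbT.
by move=> f; rewrite inE => /andP[].
Qed.

(** For a fixed block the possible images partition the injections, so the weights of its events add
    up to probabilities of properties of its image. *)
Lemma sum_weights (P : J -> pred {set U}) :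
  \sum_(i in B | P i.1 i.2) p i <=
  (\sum_j #|[set f in O | bad j (img f j) && P j (img f j)]|%:R) / #|O|%:R.
Proof.
rewrite /p -mulr_suml ler_wpM2r ?invr_ge0 //.
rewrite -!natr_sum ler_nat.
rewrite [leqRHS](eq_bigr (fun j =>
  \sum_(T | bad j T && P j T) #|covers b (j, T) :&: O|))%N; last first.
  by move=> j _; rewrite (sum_covers j (fun T => bad j T && P j T)).
rewrite pair_big_dep /= [leqLHS]big_mkcond [leqRHS]big_mkcond /=.
apply: leq_sum => -[j T] _ /=; rewrite inE /=.
by case: (bad j T) => //=; case: (P j T); case: (_ <= M)%N.
Qed.

Lemma token_weight_le (c : J + U) : \sum_(i in B | c \in tok i) p i <= eps.
Proof.
have O0 : 0 < #|O|%:R :> R by rewrite ltr0n.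
case: c => [j|u].
  rewrite (eq_bigl (fun i => (i \in B) && (j == i.1))); last first.
    by move=> i; rewrite in_tokl.
  apply: (le_trans (sum_weights (fun j' _ => j == j'))).
  rewrite ler_pdivrMr // (bigD1 j) //= big1 ?addr0; last first.
    move=> j' j'j; rewrite (_ : [set _ in _ | _] = set0) ?cards0 //.
    by apply/setP => f; rewrite !inE eq_sym (negPf j'j) !andbF.
  apply: le_trans (bad_block j); rewrite ler_nat subset_leq_card //.
  by apply/subsetP => f; rewrite !inE => /and3P[-> ->].
rewrite (eq_bigl (fun i => (i \in B) && (u \in i.2))); last first.
  by move=> i; rewrite in_tokr.
apply: (le_trans (sum_weights (fun _ T => u \in T))).
by rewrite ler_pdivrMr.
Qed.

Lemma lopsided_weight i (S : {set J * {set U}}) : i \in B ->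
  {in S, forall i', [disjoint tok i & tok i']} ->
  #|covers b i :&: avoid O (covers b) S|%:R <= p i * #|avoid O (covers b) S|%:R.
Proof.
move=> _ dis; rewrite /p mulrAC ler_pdivlMr ?ltr0n // -!natrM ler_nat.
apply: covers_lopsided => i' /dis d; apply/andP; split.
  apply/eqP => eqi; have := disjointFr d (_ : inl i.1 \in tok i).
  by rewrite !in_tokl eqi eqxx => /(_ isT).
apply/pred0P => u /=; apply/negP => /andP[ui ui'].
by have := disjointFr d (_ : inr u \in tok i); rewrite !in_tokr ui ui' => /(_ isT).
Qed.

Lemma tok_card i : i \in B -> (#|tok i| <= M.+1)%N.
Proof.
rewrite inE => /andP[_ iM]; apply: (leq_trans (leq_card_setU _ _).1).
by rewrite cards1 ltnS (leq_trans (leq_imset_card _ _)).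
Qed.

Lemma p_ge0 i : 0 <= p i.
Proof. by rewrite /p divr_ge0. Qed.

(** Every event carries the token of its block, so the block tokens alone meet all events. *)
Lemma good_sinj_gt0 : (0 < #|good_sinj|)%N.
Proof.
rewrite -avoid_bad.
apply: (local_lemma_gt0 p_ge0 lopsided_weight tok_card token_weight_le M_eps
  (cs := [seq inl j | j <- enum J])) => // i _.
rewrite disjoint_sym; apply/pred0Pn; exists (inl i.1) => /=.
rewrite in_tokl eqxx andbT; apply: map_f; exact: mem_enum.
Qed.

(** A prescribed pair touches two tokens, its block and its value, whence the factor [4 = 2 ^ 2].
    Once the events touching them are dropped, [ext_avoid_le] applies to the rest. *)
Lemma good_sinj_ext (g : seq (W * U)) : uniq (unzip1 g) ->
  (#|ext g :&: good_sinj| * ext_weight cU g)%N%:R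
    <= 4 ^+ size g * #|good_sinj|%:R :> R.
Proof.
move=> ug; have [e0|/set0Pn[f /setIP[fg fG]]] := eqVneq (ext g :&: good_sinj) set0.
  by rewrite e0 cards0 mul0n mulr_ge0 ?exprn_ge0.
have fO : f \in O by move: fG; rewrite inE => /andP[].
have [u2 _] := ext_valid ug fg fO.
pose cs := flatten [seq [:: inl (b q.1); inr q.2] | q <- g].
have szc : size cs = (2 * size g)%N.
  by rewrite /cs; elim: (g) => //= q g' ->; rewrite mulnS.
have := local_lemma_tokens p_ge0 lopsided_weight tok_card token_weight_le M_eps cs.
rewrite avoid_bad szc exprM (_ : 2 ^+ 2 = 4); last by rewrite expr2; lra.
apply: le_trans; rewrite ler_nat; set S := [set i in B | _].
have sub : good_sinj \subset avoid O (covers b) S.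
  by rewrite -avoid_bad; apply/avoidS/subsetP => i; rewrite inE => /andP[].
apply: leq_trans (ext_avoid_le cW cU (b := b) (S := S) u2 _).
  by rewrite leq_mul2r subset_leq_card ?orbT ?setIS.
apply/forall_inP => i; rewrite inE => /andP[_ dis]; apply/allP => q qg.
have incs c : c \in [:: inl (b q.1); inr q.2] -> c \in cs.
  by move=> cq; apply/flattenP; exists [:: inl (b q.1); inr q.2] => //; apply: map_f.
apply/andP; split.
  have /disjointFl/(_ (incs (inl (b q.1)) _)) := dis.
  by rewrite in_tokl mem_head => /(_ isT) ->.
have /disjointFl/(_ (incs (inr q.2) _)) := dis.
by rewrite in_tokr !inE eqxx orbT => /(_ isT) ->.
Qed.

End GoodInjections.

(** * Weights of partial injections *)

(** Induction on both numbers: the step costs a factor [(1 + 1/N) ^ r], at most [(1 + 1/N) ^ N <= e]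
    because [r <= N]. *)
Lemma expR_ffact (R : realType) (N r : nat) : (r <= N)%N ->
  N%:R ^+ r <= expR 1 ^+ r * (N ^_ r)%:R :> R.
Proof.
elim: N r => [|N IHN] [|r] //; rewrite ?expr0 ?mul1r ?ffactn0 // ltnS => rN.
rewrite ffactSS natrM !exprS.
rewrite [leRHS](_ : _ = N.+1%:R * (expR 1 * (expR 1 ^+ r * (N ^_ r)%:R))); last by ring.
rewrite ler_wpM2l //.
apply: le_trans (ler_wpM2l (expR_ge0 1) (IHN r rN)).
have [N0|N0] := posnP N.
  move: rN; rewrite N0 leqn0 => /eqP ->; rewrite !expr0 mulr1.
  by have := expR_ge1Dx (1 : R); lra.
have N0R : 0 < N%:R :> R by rewrite ltr0n.
have -> : N.+1%:R = N%:R * (1 + N%:R^-1) :> R.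
  by rewrite mulrDr mulr1 divff ?gt_eqF // -natr1.
rewrite exprMn mulrC ler_wpM2r ?exprn_ge0 //.
have ge1 : 1 <= 1 + N%:R^-1 :> R by rewrite lerDl invr_ge0.
apply: (le_trans (ler_weXn2l ge1 rN)).
apply: (@le_trans _ _ (expR N%:R^-1 ^+ N)).
  by apply: lerXn2r; rewrite ?nnegrE ?expR_ge0 ?(le_trans ler01) ?expR_ge1Dx.
by rewrite -expRM_natl divff ?gt_eqF.
Qed.

Section Weights.
Variables (R : realType) (W U K : finType) (cW : W -> K) (cU : U -> K).

Definition sort_size (c : K) : nat := #|[set z | cU z == c]|.

Lemma card_free (g : seq (W * U)) c : uniq (unzip2 g) ->
  #|free cU g c| = (sort_size c - count (fun p => cU p.2 == c) g)%N.
Proof.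
move=> ug; rewrite /sort_size.
have -> : free cU g c =
    [set z | cU z == c] :\: [set z in [seq u <- unzip2 g | cU u == c]].
  apply/setP => z; rewrite !inE mem_filter.
  by case: (cU z == c); rewrite ?andbT ?andbF.
rewrite cardsDS; last first.
  by apply/subsetP => z; rewrite !inE mem_filter => /andP[].
congr (_ - _)%N; rewrite cardsE (card_uniqP _) ?filter_uniq //.
by rewrite size_filter /unzip2 count_map.
Qed.

Lemma ext_weightE (g : seq (W * U)) : uniq (unzip2 g) ->
  ext_weight cU g = (\prod_c sort_size c ^_ count (fun p => cU p.2 == c) g)%N.
Proof.
elim: g => [|q g IHg] /= => [_|/andP[qg ug]].
  by rewrite big1.
rewrite IHg // card_free // (bigD1 (cU q.2)) //= [RHS](bigD1 (cU q.2)) //=.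
rewrite eqxx add1n ffactnSr mulnCA mulnA; congr (_ * _)%N.
by apply: eq_bigr => c; rewrite eq_sym => /negPf ->.
Qed.

Lemma count_le_sort_size (g : seq (W * U)) c : uniq (unzip2 g) ->
  (count (fun p => cU p.2 == c) g <= sort_size c)%N.
Proof.
move=> ug.
have -> : count (fun p => cU p.2 == c) g = size [seq u <- unzip2 g | cU u == c].
  by rewrite size_filter /unzip2 count_map.
rewrite -(card_uniqP (filter_uniq _ ug)) /sort_size -cardsE.
apply/subset_leq_card/subsetP => z.
by rewrite !inE mem_filter => /andP[].
Qed.

Lemma ext_weight_ge (n : nat) (g : seq (W * U)) : uniq (unzip2 g) ->
  all (fun p => (n <= sort_size (cU p.2))%N) g ->
  n%:R ^+ size g <= expR 1 ^+ size g * (ext_weight cU g)%:R :> R.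
Proof.
move=> ug ng; rewrite ext_weightE // natr_prod.
have szg : size g = (\sum_c count (fun p => cU p.2 == c) g)%N.
  elim: (g) => [|q g' IH] /=; first by rewrite big1.
  by rewrite big_split /= -IH (bigD1 (cU q.2)) //= eqxx big1 // => c;
     rewrite eq_sym => /negPf ->.
rewrite szg -!prodrXr -big_split /=.
apply: ler_prod => c _; rewrite exprn_ge0 //=.
apply: le_trans (expR_ffact _ (count_le_sort_size c ug)).
(* A sort absent from [g] may have fewer than [n] elements; its exponent is zero. *)
have [->|] := posnP (count (fun p => cU p.2 == c) g); first by rewrite !expr0.
rewrite -has_count => /hasP[q qg /eqP qc].
by apply: lerXn2r; rewrite ?nnegrE // ler_nat -qc; move/allP: ng; apply.
Qed.

(** At most [size h + size g] values are ever taken, so [D] values stay free at each step. This is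
    the comparison of sampling without replacement with independent sampling. *)
Lemma ext_cat_le (D : nat) (h g : seq (W * U)) :
  uniq (unzip1 (h ++ g)) ->
  all (fun p => (D + size h + size g <= sort_size (cU p.2))%N) h ->
  (#|ext (h ++ g) :&: sinj cW cU| * D ^ size h
     <= #|ext g :&: sinj cW cU|)%N.
Proof.
elim: h => [|[x y] h IHh] /=; first by rewrite muln1.
move=> /andP[xg ug] /andP[Dy Dh].
have [e0|/set0Pn[f /setIP[fg fO]]] :=
  eqVneq (ext ((x, y) :: h ++ g) :&: sinj cW cU) set0; first by rewrite e0 cards0.
have ug1 : uniq (unzip1 ((x, y) :: h ++ g)) by rewrite /= xg.
have [/= /andP[yg u2] _] := ext_valid ug1 fg fO.
rewrite expnS mulnA; apply: leq_trans (IHh ug _); last first.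
  by apply: sub_all Dh => q; apply: leq_trans; rewrite addnS.
rewrite leq_mul2r; apply/orP; right.
(* With no event to avoid, [ext_step_le] is a plain count and any block map will do. *)
have ap0 : apart (fun _ : W => tt) set0 [:: (x, y)].
  by apply/forall_inP => i; rewrite inE.
have := ext_step_le cW cU yg ap0; rewrite avoid0; apply: leq_trans.
rewrite leq_mul2l card_free //; apply/orP; right.
have : (count (fun p => cU p.2 == cU y) (h ++ g) <= size h + size g)%N.
  by rewrite -size_cat count_size.
move: Dy => /=; lia.
Qed.

End Weights.

(** * Lower tails of degrees in a random set *)

Section Averaging.
Variables (W : finType) (R0 : {set W}) (h l : nat).

(** Arrays whose [h] rows are disjoint [l]-sets. Averaging over them is Hoeffding's way of writing a
    U-statistic as a mean of sums over disjoint tuples. *)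
Definition inj_ffuns : {set {ffun 'I_h * 'I_l -> W}} :=
  [set th in ffun_on R0 | injectiveb th].

Definition row (th : {ffun 'I_h * 'I_l -> W}) (b : 'I_h) : {set W} :=
  [set th (b, i) | i : 'I_l].

Definition lsets : {set {set W}} := [set e : {set W} | e \subset R0 & #|e| == l].

Lemma inj_ffunsP (th : {ffun 'I_h * 'I_l -> W}) :
  reflect ((forall q, th q \in R0) /\ injective th) (th \in inj_ffuns).
Proof.
by rewrite inE; apply: (iffP andP) => -[/ffun_onP ? /injectiveP ?].
Qed.

Lemma row_lsets th b : th \in inj_ffuns -> row th b \in lsets.
Proof.
case/inj_ffunsP => thR thI; rewrite inE; apply/andP; split.
  by apply/subsetP => _ /imsetP[i _ ->].
by rewrite card_imset ?card_ord // => i i' /thI [].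
Qed.

(** List [R0] as [e] followed by its complement, do the same with [e'], and match the two lists.
    Composing arrays with [nu] then shows that a row of a random array is uniform. *)
Lemma exchange_lsets e e' : e \in lsets -> e' \in lsets ->
  exists nu : W -> W, [/\ {in R0 &, injective nu},
    forall w, w \in R0 -> nu w \in R0 & nu @: e = e'].
Proof.
rewrite !inE => /andP[eR /eqP el] /andP[e'R /eqP e'l].
pose s (a : {set W}) := enum a ++ enum (R0 :\: a).
have sz (a : {set W}) : a \subset R0 -> size (s a) = #|R0|.
  by move=> aR; rewrite size_cat -!cardE cardsDS // subnKC ?subset_leq_card.
have mem_s (a : {set W}) w : a \subset R0 -> (w \in s a) = (w \in R0).
  move=> /subsetP aR; rewrite mem_cat !mem_enum in_setD.
  by case: (boolP (w \in a)) => //= /aR.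
have uniq_s (a : {set W}) : uniq (s a).
  rewrite cat_uniq !enum_uniq andbT /=; apply/hasPn => w.
  by rewrite !mem_enum in_setD => /andP[].
pose nu w := nth w (s e') (index w (s e)).
have idx w : w \in R0 -> (index w (s e) < size (s e'))%N.
  by move=> wR; rewrite sz // -(sz e) // index_mem mem_s.
have nuI : {in R0 &, injective nu}.
  move=> w w' wR w'R; rewrite /nu (set_nth_default w') ?idx // => /eqP.
  rewrite nth_uniq ?idx // => /eqP eqi.
  by rewrite -(nth_index w (_ : w \in s e)) ?mem_s // eqi nth_index ?mem_s.
exists nu; split=> //.
  by move=> w wR; rewrite -(mem_s e') // mem_nth ?idx.
apply/eqP; rewrite eqEcard card_in_imset ?el ?e'l ?leqnn ?andbT; last first.
  by move=> w w' /(subsetP eR) wR /(subsetP eR); apply: nuI.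
apply/subsetP => _ /imsetP[w we ->].
rewrite /nu /s index_cat mem_enum we nth_cat.
have lt : (index w (enum e) < size (enum e'))%N.
  by rewrite -cardE e'l -el cardE index_mem mem_enum.
by rewrite lt -mem_enum mem_nth.
Qed.

Definition row_count b e := #|[set th in inj_ffuns | row th b == e]|.

Lemma row_count_le b e e' : e \in lsets -> e' \in lsets ->
  (row_count b e <= row_count b e')%N.
Proof.
move=> eL e'L; have [nu [nuI nuR nue]] := exchange_lsets eL e'L.
pose F (th : {ffun 'I_h * 'I_l -> W}) := [ffun q => nu (th q)].
rewrite /row_count -(@card_in_imset _ _ F); last first.
  move=> th th'; rewrite inE => /andP[/inj_ffunsP[thR _] _].
  rewrite inE => /andP[/inj_ffunsP[th'R _] _] /ffunP eqF.
  by apply/ffunP => q; have := eqF q; rewrite !ffunE => /nuI; apply.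
apply/subset_leq_card/subsetP => _ /imsetP[th + ->].
rewrite inE => /andP[/inj_ffunsP[thR thI] /eqP the].
rewrite inE; apply/andP; split.
  apply/inj_ffunsP; split=> [q|q q']; rewrite !ffunE ?nuR // => /nuI eqn.
  by apply: thI; apply: eqn.
rewrite -nue -the /row -imset_comp; apply/eqP/eq_imset => i /=.
by rewrite ffunE.
Qed.

Lemma row_countE b e : e \in lsets -> (row_count b e * 'C(#|R0|, l) = #|inj_ffuns|)%N.
Proof.
move=> eL; rewrite -(cards_draws R0 l) -/lsets mulnC -sum_nat_const.
rewrite -[RHS]sum1_card (partition_big (fun th => row th b) (mem lsets)) /=; last first.
  by move=> th; apply: row_lsets.
apply: eq_bigr => e' e'L; rewrite sum1_card.
transitivity (row_count b e'); first by apply/eqP; rewrite eqn_leq !row_count_le.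
by apply: eq_card => th; rewrite inE.
Qed.

(** Linearity and the uniformity of each row: the mean number of rows satisfying [P] is [h] times
    the density of [P]. *)
Lemma sum_rows (P : pred {set W}) :
  ((\sum_(th in inj_ffuns) \sum_(b < h) P (row th b)) * 'C(#|R0|, l)
     = h * (#|inj_ffuns| * #|[set e in lsets | P e]|))%N.
Proof.
rewrite exchange_big /= big_distrl /=.
transitivity (\sum_(b < h) #|inj_ffuns| * #|[set e in lsets | P e]|)%N; last first.
  by rewrite sum_nat_const card_ord.
apply: eq_bigr => b _.
rewrite (partition_big (fun th => row th b) (mem lsets)) /=; last first.
  by move=> th; apply: row_lsets.
rewrite big_distrl -[#|[set e in lsets | P e]|]sum1_card big_distrr /=.
rewrite big_mkcond [RHS]big_mkcond /=.
apply: eq_bigr => e _; rewrite [e \in [set _ in _ | _]]inE.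
case: (boolP (e \in lsets)) => //= eL.
rewrite (eq_bigr (fun=> P e : nat)); last by move=> th /andP[_ /eqP ->].
rewrite sum_nat_const mulnAC; case: (P e); last by rewrite muln0.
by rewrite !muln1 -(row_countE b eL) /row_count cardsE; congr (_ * _)%N; apply: eq_card.
Qed.

Lemma inj_ffuns_gt0 : (h * l <= #|R0|)%N -> (0 < #|inj_ffuns|)%N.
Proof.
move=> hl; rewrite /inj_ffuns card_inj_ffuns_on ffact_gt0.
by rewrite card_prod !card_ord.
Qed.

End Averaging.

(** * Exponential moments and the tail bound *)

Section Concentration.
Variables (R : realType) (W U K : finType) (cW : W -> K) (cU : U -> K) (c : K).
Variables (g0 : seq (W * U)) (R0 : {set W}) (L : {set {set U}}) (h l D : nat).
Variables (rho beta : R).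

Let A := ext g0 :&: sinj cW cU.
Let N := sort_size cU c.
Let zs : {set {ffun 'I_l -> U}} := [set z : {ffun 'I_l -> U} | [forall i, cU (z i) == c]].
Let zL := [set z in zs | [set z i | i : 'I_l] \in L].

Hypothesis g0_uniq : uniq (unzip1 g0).
Hypothesis R0_sort : forall w, w \in R0 -> cW w = c.
Hypothesis R0_g0 : forall w, w \in R0 -> w \notin unzip1 g0.
Hypothesis D_gt0 : (0 < D)%N.
Hypothesis D_le : (D + h * l + size g0 <= N)%N.
Hypothesis ND : N%:R ^+ (h * l) <= 2 * D%:R ^+ (h * l) :> R.
Hypothesis rho_ge0 : 0 <= rho.
Hypothesis rho_le1 : rho <= 1.
Hypothesis rho_zL : rho * N%:R ^+ l <= #|zL|%:R.
Hypothesis beta_ge0 : 0 <= beta.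

(** The contribution of one row to the exponential moment when its entries are drawn independently
    from the sort [c]. *)
Let w (z : {ffun 'I_l -> U}) : R :=
  (z \in zs)%:R * expR (- beta * ([set z i | i : 'I_l] \in L)%:R).

Lemma card_zs : #|zs| = (N ^ l)%N.
Proof.
rewrite -[l in RHS]card_ord -[N]/(#|[set z | cU z == c]|) -card_ffun_on.
apply: eq_card => z; rewrite inE.
by apply/forallP/ffun_onP => zc i; have := zc i; rewrite inE.
Qed.

(** From [exp (- beta) <= 1 / (1 + beta) <= 1 - beta + beta ^ 2]. *)
Lemma one_sub_expRN : beta - beta ^+ 2 <= 1 - expR (- beta).
Proof.
have e0 := expR_gt0 (- beta); have e1 : expR (- beta) * expR beta = 1.
  by rewrite -expRD addNr expR0.
have : expR (- beta) * (1 + beta) <= 1.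
  by rewrite -[leRHS]e1 ler_wpM2l ?expR_ge0 ?expR_ge1Dx.
have b3 : 0 <= beta ^+ 3 by rewrite exprn_ge0.
have b4 : 0 < 1 + beta by rewrite ltr_pwDl.
rewrite -ler_pdivlMr // => le1.
have : (1 + beta)^-1 <= 1 - beta + beta ^+ 2.
  by rewrite -div1r ler_pdivrMr //; move: b3; rewrite !exprS expr0; lra.
by move: le1; rewrite div1r; lra.
Qed.

Lemma sum_w : \sum_z w z <= N%:R ^+ l * expR (beta ^+ 2 - rho * beta).
Proof.
have e0 : 0 <= 1 - expR (- beta).
  by rewrite subr_ge0 -[leRHS]expR0 ler_expR oppr_le0.
have -> : \sum_z w z = N%:R ^+ l - #|zL|%:R * (1 - expR (- beta)).
  rewrite -natrX -card_zs -[X in X%:R - _]sum1_card -[X in _ - X%:R * _]sum1_card.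
  rewrite !natr_sum mulr_suml [X in X - _]big_mkcond [X in _ - X]big_mkcond -sumrB /=.
  apply: eq_bigr => z _; rewrite /w [z \in zL]inE.
  case: (z \in zs) => /=; last by rewrite mul0r subr0.
  case: (_ \in L); rewrite ?mulr1 ?mulr0 ?expR0 ?mul1r; lra.
have N0 : 0 <= N%:R ^+ l :> R by rewrite exprn_ge0.
apply: (@le_trans _ _ (N%:R ^+ l * (1 + (beta ^+ 2 - rho * beta)))); last first.
  by rewrite ler_wpM2l ?expR_ge1Dx.
have h1 : rho * N%:R ^+ l * (1 - expR (- beta)) <= #|zL|%:R * (1 - expR (- beta)).
  by rewrite ler_wpM2r.
have h2 : N%:R ^+ l * (rho * (beta - beta ^+ 2))
    <= N%:R ^+ l * (rho * (1 - expR (- beta))).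
  by rewrite !ler_wpM2l ?one_sub_expRN.
have h3 : N%:R ^+ l * (rho * beta ^+ 2) <= N%:R ^+ l * beta ^+ 2.
  by rewrite ler_wpM2l // ler_piMl // exprn_ge0.
lra.
Qed.

Definition row_hits (th : {ffun 'I_h * 'I_l -> W}) (f : {ffun W -> U}) : nat :=
  (\sum_(b < h) (f @: row th b \in L))%N.

(* Replacing sampling without replacement by independent sampling costs a factor
   [(N / D) ^ (h * l)], at most [2] by [ND]; the rows then become independent. *)
Lemma chernoff th : th \in inj_ffuns R0 h l ->
  \sum_(f in A) expR (- beta * (row_hits th f)%:R)
    <= 2 * #|A|%:R * expR (h%:R * (beta ^+ 2 - rho * beta)).
Proof.
move=> /inj_ffunsP[thR thI].
pose vals (f : {ffun W -> U}) : {ffun 'I_h -> {ffun 'I_l -> U}} :=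
  [ffun b => [ffun i => f (th (b, i))]].
have D0 : 0 < D%:R ^+ (h * l) :> R by rewrite exprn_gt0 ?ltr0n.
have imgE (f : {ffun W -> U}) b : f @: row th b = [set vals f b i | i : 'I_l].
  by rewrite /row -imset_comp; apply: eq_imset => i; rewrite /= !ffunE.
have key Y : \sum_(f in A | vals f == Y) expR (- beta * (row_hits th f)%:R)
    <= #|A|%:R / D%:R ^+ (h * l) * \prod_b w (Y b).
  have w0 : 0 <= \prod_b w (Y b).
    by apply: prodr_ge0 => b _; rewrite mulr_ge0 ?expR_ge0.
  (* If no [f] in [A] takes the values [Y], the sum is empty; otherwise a witness shows that every
     row of [Y] has the right sort, so the indicators in [w] are 1. *)
  have [e0|[f1 f1A f1Y]] : (forall f, f \in A -> vals f != Y) \/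
      exists2 f, f \in A & vals f == Y.
    case: (boolP [exists f in A, vals f == Y]) => [/exists_inP|]; [by right|].
    by rewrite negb_exists_in => /forall_inP; left.
    rewrite big1 ?mulr_ge0 ?invr_ge0 ?(ltW D0) // => f /andP[/e0 /negPf->] //.
  have Yzs b : Y b \in zs.
    rewrite inE; apply/forallP => i; rewrite -(eqP f1Y) !ffunE.
    by case/setIP: f1A => _ /sinjP[_ ->]; rewrite R0_sort.
  rewrite [leLHS](eq_bigr (fun=> \prod_b w (Y b))); last first.
    move=> f /andP[_ /eqP fY]; rewrite /row_hits natr_sum mulr_sumr expR_sum.
    by apply: eq_bigr => b _; rewrite /w Yzs mul1r imgE fY.
  rewrite sumr_const -[_ *+ _]mulr_natl ler_wpM2r // ler_pdivlMr //.
  rewrite -natrX -natrM ler_nat.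
  pose s := [seq (th q, Y q.1 q.2) | q <- enum (('I_h * 'I_l)%type : finType)].
  have sz : size s = (h * l)%N by rewrite size_map -cardE card_prod !card_ord.
  have s1 : unzip1 s = [seq th q | q <- enum (('I_h * 'I_l)%type : finType)].
    by rewrite /unzip1 -map_comp.
  have us : uniq (unzip1 (s ++ g0)).
    rewrite [unzip1 _]map_cat -/(unzip1 s) -/(unzip1 g0) s1 cat_uniq g0_uniq.
    rewrite andbT map_inj_uniq ?enum_uniq //=.
    apply/hasPn => x xg; apply/mapP => -[q _ xq].
    by have := R0_g0 (thR q); rewrite -xq xg.
  have := ext_cat_le cW (cU := cU) (D := D) us; rewrite sz.
  move=> /(_ _) le1; apply: leq_trans (le1 _); last first.
    apply/allP => _ /mapP[q _ ->] /=; have := Yzs q.1; rewrite inE.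
    by move=> /forallP/(_ q.2)/eqP ->.
  rewrite leq_mul2r; apply/orP; right; apply/subset_leq_card/subsetP => f.
  move=> /andP[/setIP[fg fO] /eqP fY]; rewrite in_setI fO andbT.
  move: fg; rewrite !inE all_cat => ->; rewrite andbT.
  apply/allP => _ /mapP[q _ ->] /=; rewrite -fY !ffunE.
  by case: q.
rewrite (partition_big vals predT) //=.
apply: (le_trans (ler_sum _ (fun Y _ => key Y))).
(* Independence of the rows: the sum over all value arrays factors into [h] equal sums. *)
rewrite -mulr_sumr -(bigA_distr_bigA (fun _ z => w z)) prodr_const card_ord.
have w0 : 0 <= \sum_z w z by apply: sumr_ge0 => z _; rewrite mulr_ge0 ?expR_ge0.
apply: (@le_trans _ _ (#|A|%:R / D%:R ^+ (h * l) *
    (N%:R ^+ l * expR (beta ^+ 2 - rho * beta)) ^+ h)).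
  apply: ler_wpM2l; first by rewrite mulr_ge0 ?invr_ge0 ?(ltW D0).
  by apply: lerXn2r; rewrite ?nnegrE ?(le_trans w0 sum_w) ?sum_w.
rewrite exprMn -exprM expRM_natl mulrA ler_wpM2r ?exprn_ge0 ?expR_ge0 //.
rewrite mulrAC ler_pdivrMr // [2 * _]mulrC -mulrA ler_wpM2l // mulnC.
exact: ND.
Qed.

(** Markov's inequality for the exponential moment summed over all arrays. The margin [2 * beta]
    gains [2 * h * beta ^ 2] in the exponent, against the second-order loss [h * beta ^ 2] in
    [chernoff]. *)
Lemma concentration : (0 < h)%N -> (h * l <= #|R0|)%N ->
  #|[set f in A | #|[set e in lsets R0 l | f @: e \in L]|%:R
      <= (rho - 2 * beta) * 'C(#|R0|, l)%:R]|%:R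
    <= 2 * #|A|%:R * expR (- (h%:R * beta ^+ 2)) :> R.
Proof.
move=> h0 hl; set Bad := [set f in A | _].
pose T := inj_ffuns R0 h l; pose tau := h%:R * (rho - 2 * beta).
have T0 : 0 < #|T|%:R :> R by rewrite ltr0n inj_ffuns_gt0.
have low f : f \in Bad ->
    #|T|%:R * expR (- beta * tau) <= \sum_(th in T) expR (- beta * (row_hits th f)%:R).
  rewrite inE => /andP[_ Xf].
  have avg : \sum_(th in T) (row_hits th f)%:R <= #|T|%:R * tau.
    have C0 : 0 < 'C(#|R0|, l)%:R :> R.
      by rewrite ltr0n bin_gt0; apply: leq_trans hl; rewrite leq_pmull.
    rewrite -(ler_pM2r C0) -natr_sum -natrM.
    rewrite (sum_rows R0 h l (fun e => f @: e \in L)) !natrM.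
    rewrite -/T mulrCA /tau -[leRHS]mulrA ler_wpM2l // -mulrA ler_wpM2l //.
  (* Jensen's inequality, through the tangent line of [expR] at the mean. *)
  have tangent th : expR (- beta * tau) * (1 - beta * ((row_hits th f)%:R - tau))
      <= expR (- beta * (row_hits th f)%:R).
    have -> : - beta * (row_hits th f)%:R =
        - beta * tau + - (beta * ((row_hits th f)%:R - tau)) by ring.
    by rewrite expRD ler_wpM2l ?expR_ge0 ?expR_ge1Dx.
  apply: le_trans (ler_sum _ (fun th _ => tangent th)).
  rewrite -mulr_sumr mulrC ler_wpM2l ?expR_ge0 // sumrB -mulr_sumr sumrB.
  rewrite !sumr_const -[tau *+ _]mulr_natl.
  have := ler_wpM2l beta_ge0 avg; lra.
have up : \sum_(th in T) \sum_(f in A) expR (- beta * (row_hits th f)%:R)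
    <= #|T|%:R * (2 * #|A|%:R * expR (h%:R * (beta ^+ 2 - rho * beta))).
  apply: (le_trans (ler_sum _ (fun th thT => chernoff thT))).
  by rewrite sumr_const -[_ *+ _]mulr_natl.
have mid : #|Bad|%:R * (#|T|%:R * expR (- beta * tau)) <=
    \sum_(th in T) \sum_(f in A) expR (- beta * (row_hits th f)%:R).
  rewrite exchange_big /= -sum1_card natr_sum mulr_suml.
  apply: (@le_trans _ _
      (\sum_(f in Bad) \sum_(th in T) expR (- beta * (row_hits th f)%:R))).
    by apply: ler_sum => f fB; rewrite mul1r low.
  rewrite [leLHS]big_mkcond [leRHS]big_mkcond; apply: ler_sum => f _.
  rewrite [f \in Bad]inE; case: (f \in A) => //=; case: ifP => // _.
  by apply: sumr_ge0 => th _; apply: expR_ge0.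
have := le_trans mid up; rewrite mulrCA ler_pM2l //.
rewrite -ler_pdivlMr ?expR_gt0 // => le1; apply: (le_trans le1).
rewrite -expRN -[leLHS]mulrA -expRD.
by rewrite (_ : h%:R * _ + - (- beta * tau) = - (h%:R * beta ^+ 2)) // /tau; ring.
Qed.

End Concentration.

(** * Bad blocks *)

Definition is_inr (A B : Type) (u : A + B) : bool := if u is inr _ then true else false.

Section Link.
Variables (V C : finType) (E : {set {set V}}) (d l : nat) (D : {set V}).
Hypothesis E_card : kgraph (d + l) E.
Hypothesis D_card : #|D| = d.

Let lift (e : {set V}) : {set (V + C)} := inl @: e.

Lemma lift_inj : injective lift.
Proof. by apply: imset_inj => u v []. Qed.

Definition link : {set {set (V + C)}} :=
  [set lift (e :\: D) | e in E & D \subset e].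

Lemma card_link : #|link| = degree E D.
Proof.
rewrite /link card_in_imset.
  by rewrite /degree; apply: eq_card => e; rewrite !inE.
move=> e e'; rewrite !inE => /andP[_ De] /andP[_ De'] /lift_inj eqD.
by rewrite -(setID e D) -(setID e' D) eqD (setIidPr De) (setIidPr De').
Qed.

Lemma link_card a : a \in link -> #|a| = l.
Proof.
case/imsetP => e; rewrite inE => /andP[eE De] ->.
by rewrite card_imset ?cardsDS ?(E_card eE) ?D_card ?addKn // => u v [].
Qed.

(** Each set of the link has [l!] enumerations, and different sets share none. Tuples are what
    [concentration] samples. *)
Lemma link_tuples : (degree E D * l`!
  <= #|[set z in [set z : {ffun 'I_l -> V + C} | [forall i, is_inr (z i) == false]] |
         [set z i | i : 'I_l] \in link]|)%N.
Proof.
rewrite -card_link -sum_nat_const.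
pose inj_in (a : {set (V + C)}) :=
  [set z : {ffun 'I_l -> V + C} in ffun_on (mem a) | injectiveb z].
apply: (@leq_trans (\sum_(a in link) #|inj_in a|)%N).
  apply: leq_sum => a aL; rewrite /inj_in card_inj_ffuns_on card_ord.
  by rewrite (link_card aL) ffactnn.
have img (a : {set (V + C)}) (z : {ffun 'I_l -> V + C}) : a \in link ->
    z \in inj_in a -> [set z i | i : 'I_l] = a.
  move=> aL; rewrite inE => /andP[/ffun_onP za /injectiveP zI].
  apply/eqP; rewrite eqEcard card_imset // card_ord (link_card aL) leqnn andbT.
  by apply/subsetP => _ /imsetP[i _ ->]; apply: za.
set Z := (X in (_ <= #|X|)%N).
rewrite -[leqRHS]sum1_card.
rewrite (partition_big
  (fun z : {ffun 'I_l -> V + C} => [set z i | i : 'I_l]) (mem link)) /=; last first.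
  by move=> z; rewrite inE => /andP[].
apply: leq_sum => a aL; rewrite sum1_card; apply/subset_leq_card/subsetP => z za.
have zim := img a z aL za; rewrite unfold_in zim eqxx andbT /Z inE zim aL andbT inE.
apply/forallP => i; have /imsetP[e _ aE] := aL.
have : z i \in a by rewrite -zim imset_f.
by rewrite aE => /imsetP[v _ ->].
Qed.

End Link.

(** * The probability that a block is bad *)

Section BadBlock.
Variables (R : realType) (W V C J : finType) (cW : W -> bool) (b : W -> J).
Variables (H : C -> {set {set V}}) (d l h Q D0 : nat) (c0 a beta : R).

Let U : finType := (V + C)%type.
Let cU : U -> bool := @is_inr V C.
Let N := #|V|.

Definition deg_in (T : {set V + C}) (i : C) (D : {set V + C}) : nat :=
  #|[set e in H i | (D \subset inl @: e) && (inl @: e \subset T)]|.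

Definition vpos (j : J) : {set W} := [set w in block b j | ~~ cW w].

(** A sorted injection puts [#|vpos j|] vertices in the image of block [j], so the binomial
    coefficient counts the possible edges through a [d]-set there. *)
Definition threshold (j : J) : R := (c0 - a) * 'C(#|vpos j| - d, l)%:R.

(** Apart from the block size in [threshold j], badness is read off the image and not the injection;
    this allows events of the form (block, image). *)
Definition bad_block (j : J) (T : {set V + C}) : bool :=
  [exists i : C, (inr i \in T) && [exists D : {set V},
    [&& #|D| == d, inl @: D \subset T & (deg_in T i (inl @: D))%:R < threshold j]]].

Hypothesis H_card : forall i, kgraph (d + l) (H i).
Hypothesis H_deg : forall i (D : {set V}), #|D| = d ->
  c0 * 'C(N - d, l)%:R <= (degree (H i) D)%:R.
Hypothesis h_gt0 : (0 < h)%N.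
Hypothesis D0_gt0 : (0 < D0)%N.
Hypothesis D0_le : (D0 + h * l + d.+2 <= N)%N.
Hypothesis D0_N : N%:R ^+ (h * l) <= 2 * D0%:R ^+ (h * l) :> R.
Hypothesis beta_gt0 : 0 < beta.
Hypothesis beta_half : 2 * beta <= 1.
Hypothesis beta_a : 5 * beta <= a.
Hypothesis N_ffact : (1 - beta) * N%:R ^+ l <= ((N - d) ^_ l)%:R.

Lemma sort_size_inl : sort_size cU false = N.
Proof.
rewrite /sort_size /N -(card_imset V (@inl_inj V C)); apply: eq_card => -[v|i].
  by rewrite !inE /= imset_f.
by rewrite !inE /=; apply/esym/negbTE/imsetP => -[].
Qed.

Definition inl_set (T : {set V + C}) : {set V} := [set v | inl v \in T].

Lemma inl_set_lift (e : {set V}) : inl_set (inl @: e) = e.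
Proof. by apply/setP => v; rewrite inE mem_imset // => ? ? []. Qed.

Lemma lift_inl_set (f : {ffun W -> V + C}) (P : {set W}) j : f \in sinj cW cU ->
  P \subset vpos j -> inl @: inl_set (f @: P) = f @: P.
Proof.
move=> /sinjP[_ fc] /subsetP Pj; apply/setP => -[v|i].
  by rewrite mem_imset ?inE // => ? ? [].
apply/imsetP/imsetP => [[v _ //]|[w wP fw]].
by have := Pj w wP; rewrite !inE -fc -fw /= andbF.
Qed.

(** Adjoining [P] to [e] gives a set whose image is an edge through [D] inside the block, and
    disjointness from [P] lets [e] be recovered. *)
Lemma link_hits_le_deg (f : {ffun W -> V + C}) j (P e0 : {set W}) (D : {set V}) i :
  injective f -> P \subset block b j -> e0 \subset block b j -> [disjoint P & e0] ->
  f @: P = inl @: D ->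
  (#|[set e in lsets e0 l | f @: e \in link C (H i) D]|
     <= deg_in (f @: block b j) i (f @: P))%N.
Proof.
move=> fI Pj e0j dis fP.
pose G (e : {set W}) := inl_set (f @: (e :|: P)).
have GE (e : {set W}) : f @: e \in link C (H i) D ->
    [/\ G e \in H i, D \subset G e & inl @: G e = f @: (e :|: P)].
  case/imsetP => e'; rewrite inE => /andP[e'H De'] fe.
  have fU : f @: (e :|: P) = inl @: e'.
    by rewrite imsetU fe fP -imsetU setUC -{2}(setID e' D) (setIidPr De').
  by rewrite /G fU inl_set_lift.
have sub (e : {set W}) : e \in lsets e0 l -> [disjoint P & e] /\ e \subset block b j.
  rewrite inE => /andP[ee _]; split; last exact: subset_trans e0j.
  by rewrite disjoint_sym; apply: disjointWl ee _; rewrite disjoint_sym.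
rewrite -(@card_in_imset _ _ G).
  apply/subset_leq_card/subsetP => _ /imsetP[e + ->].
  rewrite 2!inE -andbA => /and3P[ee el fL].
  have [GH DG GU] := GE e fL; rewrite inE GH GU imsetS ?subsetUr //=.
  by rewrite imsetS // subUset Pj (subset_trans ee).
move=> e e'; rewrite inE => /andP[/sub[dP _] /GE[_ _ eU]].
rewrite inE => /andP[/sub[dP' _] /GE[_ _ eU']] eqG.
have : e :|: P = e' :|: P by apply: (imset_inj fI); rewrite -eU -eU' eqG.
move=> /(congr1 (fun s => s :\: P)); rewrite !setDUl setDv !setU0.
have /setDidPl -> : [disjoint e & P] by rewrite disjoint_sym.
by have /setDidPl -> : [disjoint e' & P] by rewrite disjoint_sym.
Qed.

Lemma link_density i (D : {set V}) : #|D| = d ->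
  exists2 rho : R, c0 * (1 - beta) <= rho <= 1 /\ 0 <= rho &
  rho * N%:R ^+ l <= #|[set z in [set z : {ffun 'I_l -> V + C} |
      [forall i, is_inr (z i) == false]] |
         [set z i | i : 'I_l] \in link C (H i) D]|%:R.
Proof.
move=> Dd; set zL := [set z in _ | _].
have N0 : 0 < N%:R ^+ l :> R.
  by rewrite exprn_gt0 // ltr0n; move: D0_gt0 D0_le; lia.
exists (#|zL|%:R / N%:R ^+ l); last by rewrite divfK ?gt_eqF.
split; last by rewrite divr_ge0 // ltW.
apply/andP; split; last first.
  rewrite ler_pdivrMr // mul1r -natrX ler_nat -sort_size_inl.
  rewrite -(card_zs cU false l); apply/subset_leq_card/subsetP => z.
  by rewrite inE => /andP[].
rewrite ler_pdivlMr //.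
have le1 := link_tuples C (@H_card i) Dd.
apply: (@le_trans _ _ (degree (H i) D * l`!)%:R); last by rewrite ler_nat.
(* The sign of [c0] is not prescribed; if it is not positive, the lower bound is trivial. *)
have [c0le|c0gt] := leP c0 0.
  apply: le_trans (ler0n _ _); rewrite -mulrA mulr_le0_ge0 //.
  rewrite mulr_ge0 ?ltW //; have := beta_gt0; have := beta_half; lra.
rewrite natrM; apply: le_trans (ler_wpM2r (ler0n _ _) (H_deg i Dd)).
by rewrite -!mulrA ler_wpM2l ?(ltW c0gt) // -natrM bin_ffact.
Qed.

(** The prescribed values fix the target of [x], the colour [f w0] and the [d]-set [f @: P]. The
    degree is then at least a count over the remaining vertex positions, to which [concentration]
    applies with the link as [L]. *)
Lemma low_degree_rare (f0 : {ffun W -> V + C}) j x w0 (P : {set W}) i :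
  l%:R <= beta * (#|vpos j| - d)%:R -> (h * l + d.+1 <= #|vpos j|)%N ->
  f0 \in sinj cW cU -> P \subset vpos j -> #|P| = d -> f0 w0 = inr i ->
  forall g0, g0 = [seq (w, f0 w) | w <- undup (x :: w0 :: enum P)] ->
  #|[set f in ext g0 :&: sinj cW cU |
       (deg_in (f @: block b j) i (f0 @: P))%:R < threshold j]|%:R
    <= 2 * #|ext g0 :&: sinj cW cU|%:R * expR (- (h%:R * beta ^+ 2)).
Proof.
move=> lM hM f0O Pj Pd f0w0 g0 g0E.
have [t0|t0] := leP (threshold j) 0.
  rewrite (_ : [set f in _ | _] = set0).
    by rewrite cards0 !mulr_ge0 ?expR_ge0.
  by apply/setP => f; rewrite !inE; apply/negP => /andP[_]; rewrite ltNge (le_trans t0).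
pose D := inl_set (f0 @: P).
have liftD : inl @: D = f0 @: P by apply: lift_inl_set f0O Pj.
have /sinjP[f0I f0c] := f0O.
have Dd : #|D| = d by rewrite -Pd -(card_imset P f0I) -liftD card_imset // => ? ? [].
have [rho [/andP[c0rho rho1] rho0] rhoL] := link_density i Dd.
pose Y0 := undup (x :: w0 :: enum P).
have szY : (size Y0 <= d.+2)%N.
  by rewrite (leq_trans (size_undup _)) //= -cardE Pd.
(* The values on [Y0] are prescribed, so only the other positions are random. *)
pose R0 := [set w in vpos j | w \notin Y0].
have un : unzip1 g0 = Y0 by rewrite g0E /unzip1 -map_comp map_id.
have PY : P \subset Y0.
  by apply/subsetP => w wP; rewrite mem_undup !inE mem_enum wP !orbT.
have w0v : w0 \notin vpos j by rewrite !inE -f0c f0w0 andbF.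
have R0le : (#|vpos j| - d <= #|R0|.+1)%N.
  have sub : vpos j \subset x |: (P :|: R0).
    apply/subsetP => w wj; rewrite in_setU1 in_setU.
    have [//|wx] := eqVneq w x; case: (boolP (w \in P)) => //= wP.
    rewrite [w \in R0]inE wj /= mem_undup !in_cons mem_enum (negPf wx) (negPf wP).
    by rewrite orbF; apply: contraNneq w0v => <-.
  rewrite leq_subLR addnS; apply: leq_trans (subset_leq_card sub) _.
  apply: leq_trans (leq_card_setU _ _).1 _; rewrite cards1 add1n ltnS.
  by apply: leq_trans (leq_card_setU _ _).1 _; rewrite Pd.
have hR : (h * l <= #|R0|)%N.
  by rewrite -ltnS (leq_trans _ R0le) // ltn_subRL addnC -addnS.
have R0P : (#|R0| <= #|vpos j| - d)%N.
  rewrite -Pd -cardsDS //; apply/subset_leq_card/subsetP => w.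
  rewrite inE => /andP[wj wY]; rewrite inE wj andbT.
  by apply: contra wY => /(subsetP PY).
have ug0 : uniq (unzip1 g0) by rewrite un undup_uniq.
have R0s w : w \in R0 -> cW w = false.
  by rewrite !inE => /andP[/andP[_ /negPf]].
have R0g w : w \in R0 -> w \notin unzip1 g0 by rewrite un inE => /andP[].
have D0le : (D0 + h * l + size g0 <= sort_size cU false)%N.
  rewrite sort_size_inl g0E size_map; apply: leq_trans D0_le; rewrite leq_add2l //.
have ND : (sort_size cU false)%:R ^+ (h * l) <= 2 * D0%:R ^+ (h * l) :> R.
  by rewrite sort_size_inl.
have rhoL' : rho * (sort_size cU false)%:R ^+ l <=
    #|[set z in [set z : {ffun 'I_l -> V + C} |
      [forall i, cU (z i) == false]] |
         [set z i | i : 'I_l] \in link C (H i) D]|%:R by rewrite sort_size_inl.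
have := concentration ug0 R0s R0g D0_gt0 D0le ND rho0 rho1 rhoL' (ltW beta_gt0) h_gt0 hR.
apply: le_trans; rewrite ler_nat; apply/subset_leq_card/subsetP => f.
rewrite inE => /andP[fA flow]; rewrite inE fA /=.
have [fg /sinjP[fI _]] := setIP fA.
have fP : f @: P = f0 @: P.
  apply: eq_in_imset => w wP; move: fg; rewrite inE g0E => /allP.
  move=> /(_ (w, f0 w)) /= h1; apply/eqP/h1/map_f.
  by apply: (subsetP PY).
have vb : vpos j \subset block b j by apply/subsetP => w; rewrite inE => /andP[].
have le1 : (#|[set e in lsets R0 l | f @: e \in link C (H i) D]|
     <= deg_in (f @: block b j) i (f @: P))%N.
  apply: link_hits_le_deg => //.
  - exact: subset_trans vb.
  - by apply: subset_trans vb; apply/subsetP => w; rewrite inE => /andP[].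
  - apply/pred0P => w /=; apply/negP => /andP[wP]; rewrite inE => /andP[_ /negP]; apply.
    exact: (subsetP PY).
  - by rewrite fP liftD.
apply: (@le_trans _ _ (threshold j)).
  by apply: le_trans (ltW flow); rewrite ler_nat -fP.
have A0 : (0 < #|vpos j| - d)%N by rewrite subn_gt0 (leq_trans (leq_addl _ _) hM).
have c0a : 0 < c0 - a.
  move: t0; rewrite /threshold; case: (ltrP 0 (c0 - a)) => // le0.
  by rewrite ltNge mulr_le0_ge0.
(* Besides [P], only [x] can be missing from [R0], since [w0] is a colour position. By [lM], losing
   one position costs a factor of at least [1 - beta]. *)
have binle : (1 - beta) * 'C(#|vpos j| - d, l)%:R <= 'C(#|R0|, l)%:R :> R.
  have step : (1 - beta) * 'C(#|vpos j| - d, l)%:R <= 'C((#|vpos j| - d).-1, l)%:R :> R.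
    have A0R : 0 < (#|vpos j| - d)%:R :> R by rewrite ltr0n.
    rewrite -(ler_pM2l A0R) -[leRHS]natrM mul_bin_down natrM mulrA ler_wpM2r //.
    have : (#|vpos j| - d)%:R <= (#|vpos j| - d - l)%:R + l%:R :> R.
      by rewrite -natrD ler_nat addnC -leq_subLR.
    by move: lM; lra.
  apply: (le_trans step); rewrite ler_nat; apply: leq_bin2l.
  by rewrite -subn1 leq_subLR add1n.
have C0 : 0 <= 'C(#|vpos j| - d, l)%:R :> R by [].
(* The losses are [c0 * beta <= 2 * beta] in the density, [2 * beta] in the tail bound and at most
   [beta] in the binomial coefficient, in total [5 * beta <= a]. *)
have b0 := beta_gt0; have b1 := beta_half; have b2 := beta_a.
have c00 : 0 <= c0 by lra.
have half : c0 * 2^-1 <= c0 * (1 - beta) by apply: ler_wpM2l => //; lra.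
have c02 : c0 <= 2 by lra.
have cb : c0 * beta <= 2 * beta by rewrite ler_wpM2r // ltW.
have r2 : 0 <= rho - 2 * beta by lra.
apply: le_trans (ler_wpM2l r2 binle).
have rb : beta * (rho - 2 * beta) <= beta by apply: ler_piMr; lra.
rewrite /threshold mulrA ler_wpM2r //; lra.
Qed.


(** A union bound over at most [Q] colour positions and [Q ^ d] sets of [d] vertex positions in a
    block, each with the tail of [concentration]. *)
Definition zeta : R := (Q ^ d.+1)%:R * (2 * expR (- (h%:R * beta ^+ 2))).

Lemma ffact_le_expn n m : (n ^_ m <= n ^ m)%N.
Proof.
elim: m => [|m IHm]; first by rewrite ffactn0.
by rewrite ffactnSr expnSr leq_mul ?leq_subr.
Qed.

Hypothesis block_Q : forall j, (#|block b j| <= Q)%N.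
Hypothesis vpos_large : forall j w, w \in block b j -> cW w ->
  l%:R <= beta * (#|vpos j| - d)%:R /\ (h * l + d.+1 <= #|vpos j|)%N.

Let at_ x u := [set f in sinj cW cU | f x == u].

(* The local lemma needs the probability that a block is bad and contains a
   given [u], relative to that of containing [u]: hence the condition
   [f x = u] at an arbitrary position [x]. *)
Lemma bad_block_at x j u :
  #|[set f in at_ x u | bad_block j (f @: block b j)]|%:R <= zeta * #|at_ x u|%:R.
Proof.
pose low (w0 : W) (P : {set W}) (f : {ffun W -> V + C}) : bool :=
  if f w0 is inr i then (deg_in (f @: block b j) i (f @: P))%:R < threshold j
  else false.
pose pairs := setX (block b j) (lsets (vpos j) d).
(* The union runs over positions of the block, not over colours and [d]-sets of the host, whose
   number grows with the host. *)
have cover : [set f in at_ x u | bad_block j (f @: block b j)] \subset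
    \bigcup_(q in pairs) [set f in at_ x u | low q.1 q.2 f].
  apply/subsetP => f; rewrite inE => /andP[fx].
  have /setIdP[fO _] := fx; have /sinjP[fI fc] := fO.
  case/existsP => i /andP[/imsetP[w0 w0j fw0] /existsP[D /and3P[/eqP Dd Dj lowD]]].
  pose P := [set w in block b j | f w \in inl @: D].
  have fP : f @: P = inl @: D.
    apply/setP => z; apply/imsetP/idP => [[w + ->]|zD].
      by rewrite inE => /andP[].
    have /imsetP[w wj zw] := subsetP Dj z zD.
    by exists w; rewrite // inE wj -zw.
  apply/bigcupP; exists (w0, P); last by rewrite inE fx /low /= -fw0 fP.
  rewrite in_setX w0j inE -(card_imset P fI) fP card_imset; last by move=> ? ? [].
  rewrite Dd eqxx andbT; apply/subsetP => w; rewrite !inE => /andP[-> /imsetP[v _ fw]].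
  by rewrite -fc fw.
have each q : q \in pairs -> #|[set f in at_ x u | low q.1 q.2 f]|%:R
    <= 2 * expR (- (h%:R * beta ^+ 2)) * #|at_ x u|%:R.
  case: q => w0 P; rewrite in_setX => /andP[/= w0j]; rewrite inE => /andP[Pj /eqP Pd].
  (* [x] may be [w0] or lie in [P], hence [undup]. Splitting by the values on [s] reduces to a fixed
     colour and a fixed [d]-set. *)
  pose s := undup (x :: w0 :: enum P).
  rewrite (@card_values _ _ s (size s)) // (@card_values _ _ s (size s) (at_ x u)) //.
  rewrite !natr_sum mulr_sumr; apply: ler_sum => t _.
  have e0 : 0 <= 2 * expR (- (h%:R * beta ^+ 2)) :> R by rewrite mulr_ge0 ?expR_ge0.
  set B1 := ext _ :&: _; have [->|/set0Pn[f0]] := eqVneq B1 set0.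
    by rewrite cards0 mulr_ge0.
  rewrite in_setI => /andP[f0t]; rewrite inE => /andP[f0a f0low].
  have /setIdP[f0O f0x] := f0a.
  have ts : size s = size t by rewrite size_tuple.
  have tE : [seq f0 w | w <- s] = t by apply/eqP; rewrite -ext_zip.
  have gE : zip s t = [seq (w, f0 w) | w <- s].
    by rewrite -tE -{1}(map_id s) zip_map.
  have agree f w : f \in ext (zip s t) -> w \in s -> f w = f0 w.
    by rewrite gE inE => /allP h1 ws; apply/eqP/(h1 (w, f0 w))/map_f.
  have xs : x \in s by rewrite mem_undup mem_head.
  have ws : w0 \in s by rewrite mem_undup !inE eqxx orbT.
  have sub2 : ext (zip s t) :&: sinj cW cU \subset ext (zip s t) :&: at_ x u.
    apply/subsetP => f /setIP[ft fO]; rewrite in_setI ft inE fO /=.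
    by rewrite (agree f x) // (eqP f0x).
  move: f0low; rewrite /low; case f0w: (f0 w0) => [//|i] _.
  have [lM hM] : l%:R <= beta * (#|vpos j| - d)%:R /\ (h * l + d.+1 <= #|vpos j|)%N.
    by apply: vpos_large w0j _; have /sinjP[_ <-] := f0O; rewrite f0w.
  apply: (@le_trans _ _ (2 * #|ext (zip s t) :&: sinj cW cU|%:R
      * expR (- (h%:R * beta ^+ 2)))); last first.
    by rewrite mulrAC ler_wpM2l // ler_nat subset_leq_card.
  apply: le_trans (low_degree_rare lM hM f0O Pj Pd f0w gE).
  rewrite ler_nat; apply/subset_leq_card/subsetP => f.
  rewrite in_setI => /andP[ft]; rewrite inE => /andP[/setIdP[fO _]].
  rewrite /= /low (agree f w0) // f0w inE in_setI ft fO /=.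
  rewrite (_ : f @: P = f0 @: P) //; apply: eq_in_imset => w wP.
  by apply: agree => //; rewrite mem_undup !inE mem_enum wP !orbT.
have npairs : (#|pairs| <= Q ^ d.+1)%N.
  rewrite cardsX cards_draws expnS leq_mul ?block_Q //.
  apply: leq_trans (ffact_le_expn _ _); rewrite -bin_ffact.
  apply: (@leq_trans ('C(Q, d))); last by rewrite leq_pmulr ?fact_gt0.
  apply: leq_bin2l; apply: leq_trans (block_Q j); apply: subset_leq_card.
  by apply/subsetP => w; rewrite inE => /andP[].
apply: (@le_trans _ _ (\sum_(q in pairs) #|[set f in at_ x u | low q.1 q.2 f]|%:R)).
  rewrite -natr_sum ler_nat; apply: leq_trans (card_bigcup_le _ _).
  exact: subset_leq_card.
apply: (le_trans (ler_sum _ each)); rewrite sumr_const -[_ *+ _]mulr_natl.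
rewrite /zeta -[leRHS]mulrA ler_wpM2r ?ler_nat //.
by rewrite !mulr_ge0 ?expR_ge0.
Qed.

Lemma bad_block_prob j :
  #|[set f in sinj cW cU | bad_block j (f @: block b j)]|%:R
    <= zeta * #|sinj cW cU|%:R.
Proof.
have z0 : 0 <= zeta by rewrite !mulr_ge0 ?expR_ge0.
(* The image of an empty block has no colour, so it is not bad; otherwise one splits by the value at
   some position of the block. *)
have [b0|/set0Pn[x xj]] := eqVneq (block b j) set0.
  set S := [set _ in _ | _]; suff -> : S = set0 by rewrite cards0 mulr_ge0.
  apply/setP => f; rewrite !inE; apply/negP => /andP[_ /existsP[i /andP[]]].
  by rewrite b0 imset0 inE.
have part (A : {set {ffun W -> V + C}}) :
    #|A|%:R = \sum_u #|[set f in A | f x == u]|%:R :> R.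
  rewrite -natr_sum -sum1_card.
  rewrite (partition_big (fun f : {ffun W -> V + C} => f x) predT) //=.
  congr _%:R; apply: eq_bigr => u _.
  by rewrite -sum1_card; apply: eq_bigl => f; rewrite inE.
rewrite part (part (sinj _ _)) mulr_sumr; apply: ler_sum => u _.
apply: le_trans (bad_block_at x j u); rewrite ler_nat; apply/subset_leq_card/subsetP => f.
by rewrite !inE => /andP[/andP[-> ->] ->].
Qed.

(** If [u] is in the image of a block, some position of the block takes it, so [bad_block_at] is
    summed over positions. An injection takes the value [u] at most once, which bounds the total. *)
Lemma bad_vertex_prob u :
  \sum_j #|[set f in sinj cW cU |
      bad_block j (f @: block b j) && (u \in f @: block b j)]|%:R
    <= zeta * #|sinj cW cU|%:R.
Proof.
have z0 : 0 <= zeta by rewrite !mulr_ge0 ?expR_ge0.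
apply: (@le_trans _ _ (\sum_j \sum_(x in block b j) zeta * #|at_ x u|%:R)).
  apply: ler_sum => j _; apply: le_trans (ler_sum _ (fun x _ => bad_block_at x j u)).
  rewrite -natr_sum ler_nat; apply: leq_trans (card_bigcup_le _ _).
  apply/subset_leq_card/subsetP => f; rewrite inE => /and3P[fO fb /imsetP[x xj ux]].
  by apply/bigcupP; exists x => //; rewrite inE fb andbT inE fO ux /=.
have -> : \sum_j \sum_(x in block b j) zeta * #|at_ x u|%:R =
    zeta * (\sum_x #|at_ x u|)%:R.
  rewrite natr_sum mulr_sumr [RHS](partition_big b predT) //=.
  by apply: eq_bigr => j _; apply: eq_bigl => x; rewrite inE.
rewrite ler_wpM2l // ler_nat.
rewrite (eq_bigr (fun x => \sum_(f in sinj cW cU) (f x == u))%N); last first.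
  move=> x _; rewrite -sum1_card big_mkcond [RHS]big_mkcond.
  by apply: eq_bigr => f _; rewrite inE; case: (f \in _); case: (_ == _).
rewrite exchange_big -[leqRHS]sum1_card; apply: leq_sum => f /sinjP[fI _].
case: (boolP [exists x, f x == u]) => [/existsP[x /eqP fx]|].
  rewrite (bigD1 x) //= fx eqxx big1 // => y yx.
  by rewrite -fx (inj_eq fI) (negPf yx).
by rewrite negb_exists => /forallP nx; rewrite big1 // => x _; rewrite (negPf (nx x)).
Qed.

End BadBlock.

(** * The transversal threshold *)

Section MinDegree.
Variables (R : realFieldType) (d : nat) (V : finType) (E : {set {set V}}).

Lemma min_degree_le (D : {set V}) : #|D| = d -> (min_degree d E <= degree E D)%N.
Proof.
move=> /eqP Dd; rewrite /min_degree.
have : D \in index_enum {set V} by rewrite mem_index_enum.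
elim: (index_enum _) => //= D' r IHr; rewrite inE big_cons => /predU1P[<-|Dr].
  by rewrite Dd geq_minl.
by case: ifP => _; rewrite ?(leq_trans (geq_minr _ _)) ?IHr.
Qed.

Lemma min_degree_ge (x : R) : (d <= #|V|)%N ->
  (forall D : {set V}, #|D| = d -> x <= (degree E D)%:R) -> x <= (min_degree d E)%:R.
Proof.
move=> dV xle; have [D0 _ D0d] : exists2 D0 : {set V}, D0 \subset setT & #|D0| = d.
  pose D0 := [set x in take d (enum V)].
  exists D0; rewrite ?subsetT // cardsE (card_uniqP _) ?take_uniq ?enum_uniq //.
  by rewrite size_take -cardE; case: ltngtP dV.
have degE D : (degree E D <= #|E|)%N.
  by apply/subset_leq_card/subsetP => e; rewrite inE => /andP[].
rewrite /min_degree; elim/big_rec: _ => [|D y /eqP Dd le_y].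
  by apply: (le_trans (xle _ D0d)); rewrite ler_nat.
by rewrite /minn; case: ifP => // _; apply: xle.
Qed.

End MinDegree.

Lemma degree_le_bin (V : finType) (E : {set {set V}}) d l (D : {set V}) :
  kgraph (d + l) E -> #|D| = d -> (degree E D <= 'C(#|V| - d, l))%N.
Proof.
move=> Ek Dd; rewrite -(card_link (void : finType)).
have -> : (#|V| - d)%N = #|~: D| by rewrite cardsCs setCK Dd.
rewrite -(card_imset (~: D) (@inl_inj V void)) -cards_draws.
apply/subset_leq_card/subsetP => a aL; rewrite inE.
rewrite (link_card Ek Dd aL) eqxx andbT; case/imsetP: aL => e _ ->.
by apply: imsetS; rewrite setDE subsetIr.
Qed.

Section Transport.
Variables (VF VF' : finType) (F : {set {set VF}}) (F' : {set {set VF'}}).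
Variables (r : VF' -> VF).
Hypothesis r_bij : bijective r.
Hypothesis r_edge : forall e, e \in F' -> r @: e \in F.
Hypothesis F_card : #|F'| = #|F|.

Lemma transport_factor n m (V : finType) (H : 'I_m -> {set {set V}}) :
  has_transversal_factor F n H -> has_transversal_factor F' n H.
Proof.
have [r' rK r'K] := r_bij; have r_inj := can_inj rK.
case=> phi [[phi' phiK phi'K]] [lam [lam_bij lamH]].
exists (fun q => phi (q.1, r q.2)); split.
  exists (fun v => ((phi' v).1, r' (phi' v).2)).
    by move=> [j v]; rewrite phiK /= rK.
  by move=> v /=; rewrite r'K -surjective_pairing phi'K.
pose f (e : edge_of F') : edge_of F := Sub (r @: val e) (r_edge (valP e)).
have f_inj : injective f.
  move=> e e' /(congr1 val); rewrite !SubK => /(imset_inj r_inj) ee'.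
  exact: val_inj.
exists (fun q => lam (q.1, f q.2)); split.
  apply: bij_comp lam_bij _; apply: inj_card_bij.
    move=> [j e] [j' e'] eqje; have /= -> := congr1 fst eqje.
    by have /= /f_inj -> := congr1 snd eqje.
  by rewrite !card_prod /edge_of !card_sig F_card.
move=> j e; have := lamH j (f e); rewrite SubK.
by rewrite -imset_comp.
Qed.

Lemma transport_threshold (R : realType) k d (delta : R) : #|VF'| = #|VF| ->
  is_transversal_threshold k d F delta -> is_transversal_threshold k d F' delta.
Proof.
move=> cardV; rewrite /is_transversal_threshold F_card cardV => thr a a0.
have [n0 n0P] := thr a a0; exists n0 => n nn0 V H cV kH degH.
exact: transport_factor (n0P n nn0 V H cV kH degH).
Qed.

End Transport.

(** Invariance under isomorphism moves [F] to ['I_s], on which there are only finitely many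
    hypergraphs. *)
Lemma deltaT_transport (R : realType) k d (VF VF' : finType)
    (F : {set {set VF}}) (r : VF' -> VF) : bijective r ->
  deltaT R k d [set (r @^-1: (e : {set VF}))%SET | e : {set VF} in F] = deltaT R k d F.
Proof.
move=> r_bij; have [r' rK r'K] := r_bij.
have pre_inj : injective (fun e : {set VF} => r @^-1: e)%SET.
  move=> e e' /setP ee'; apply/setP => v; have := ee' (r' v).
  by rewrite !inE r'K.
have imgK (e : {set VF}) : (r @: (r @^-1: e))%SET = e.
  apply/setP => v; apply/imsetP/idP => [[w + ->]|ve]; first by rewrite inE.
  by exists (r' v); rewrite ?inE r'K.
have cF : #|[set (r @^-1: (e : {set VF}))%SET | e : {set VF} in F]| = #|F|.
  by rewrite card_imset.
have cV : #|VF'| = #|VF| by apply: bij_eq_card r_bij.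
rewrite /deltaT; congr inf; apply/funext => delta; apply/propext; split.
  apply: (@transport_threshold _ _ _ _ r') => //; first by exists r.
  move=> e eF; apply/imsetP; exists e => //; apply/setP => v.
  rewrite inE; apply/imsetP/idP => [[w we ->]|ve]; first by rewrite r'K.
  by exists (r v); rewrite ?rK.
apply: (@transport_threshold _ _ _ _ r) => //.
by move=> _ /imsetP[e eF ->]; rewrite imgK.
Qed.

(** If the admissible values are not bounded below, [inf] is 0 by convention and some negative value
    is admissible. Otherwise 1 is admissible and [inf_adherent] applies. *)
Lemma threshold_near (R : realType) k d (VF : finType) (F : {set {set VF}}) (eps : R) :
  (d < k)%N -> kgraph k F -> (0 < #|F|)%N -> 0 < eps ->
  exists2 delta : R, is_transversal_threshold k d F delta & delta < deltaT R k d F + eps.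
Proof.
move=> dk Fk F0 eps0; rewrite /deltaT.
set S := @is_transversal_threshold R k d VF F.
have [lbS|nlbS] := pselect (classical_sets.has_lbound S); last first.
  rewrite inf_out ?add0r; last by case.
  apply: contrapT => noS; apply: nlbS; exists 0 => delta Sd; rewrite leNgt.
  by apply/negP => d0; apply: noS; exists delta; rewrite ?(lt_trans d0).
have hasS : classical_sets.has_inf S.
  (* 1 is admissible vacuously: once [k <= n], no minimum degree exceeds the binomial
     coefficient. *)
  split=> //; exists 1 => a a0; exists k => n kn V H cV Hk degH.
  have [e eF] : exists e, e \in F by apply/card_gt0P.
  have VF0 : (0 < #|VF|)%N.
    by apply: leq_trans (max_card (mem e)); rewrite (Fk e eF) (leq_ltn_trans _ dk).
  have n0 : (0 < n)%N by apply: leq_trans kn; apply: leq_ltn_trans dk.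
  have i : 'I_(#|F| * n) by apply: (@Ordinal _ 0); rewrite muln_gt0 F0.
  have kV : (k <= #|V|)%N by rewrite cV (leq_trans kn) ?leq_pmull.
  pose D := [set x in take d (enum V)].
  have Dd : #|D| = d.
    rewrite cardsE (card_uniqP _) ?take_uniq ?enum_uniq // size_takel // -cardE.
    by apply: leq_trans kV; apply: ltnW.
  have Hdk : kgraph (d + (k - d)) (H i) by rewrite subnKC ?(ltnW dk) //; apply: Hk.
  have := degH i; rewrite -cV.
  have binP : 0 < 'C(#|V| - d, k - d)%:R :> R by rewrite ltr0n bin_gt0 leq_sub2r.
  have : (min_degree d (H i))%:R <= 'C(#|V| - d, k - d)%:R :> R.
    rewrite ler_nat; apply: leq_trans (min_degree_le _ Dd) _.
    exact: degree_le_bin.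
  have : 0 < a * 'C(#|V| - d, k - d)%:R by rewrite mulr_gt0.
  lra.
have [delta Sd lt] := inf_adherent eps0 hasS.
by exists delta.
Qed.

Lemma fin_all_bound (T : finType) (P : T -> nat -> Prop) :
  (forall x, exists n0, forall n, (n0 <= n)%N -> P x n) ->
  exists n0, forall x n, (n0 <= n)%N -> P x n.
Proof.
move=> /fin_all_exists[f fP]; exists (\max_x f x) => x n le_n; apply: fP.
exact: leq_trans (leq_bigmax x) le_n.
Qed.

(** Arbitrary finite types index copies and colours, because those of a single block come as
    subtypes. *)
Definition embeds_factor (VF J C V : finType) (F : {set {set VF}})
    (H : C -> {set {set V}}) : Prop :=
  exists phi : J * VF -> V, injective phi /\
  exists lam : J * edge_of F -> C, injective lam /\
    forall (j : J) (e : edge_of F), [set phi (j, v) | v in val e] \in H (lam (j, e)).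

(** The block size is fixed before [d] and [F], so one [m0] must serve them all: a maximum over the
    finitely many [d < k] and hypergraphs on ['I_s]. *)
Lemma uniform_threshold (R : realType) (alpha : R) (k s t : nat) :
  0 < alpha -> (0 < t)%N ->
  exists m0, forall d, (d < k)%N ->
  forall (VF : finType) (F : {set {set VF}}),
    kgraph k F -> #|VF| = s -> #|F| = t ->
  forall (J C V : finType) (H : C -> {set {set V}}),
    (m0 <= #|J|)%N -> #|C| = (t * #|J|)%N -> #|V| = (s * #|J|)%N ->
    (forall c, kgraph k (H c)) ->
    (forall c, (deltaT R k d F + alpha) * 'C(s * #|J| - d, k - d)%:R
               <= (min_degree d (H c))%:R) ->
  embeds_factor J F H.
Proof.
move=> alpha0 t0.
pose P (x : 'I_k * {set {set 'I_s}}) (n : nat) := kgraph k x.2 -> #|x.2| = t ->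
  forall (V : finType) (H : 'I_(t * n) -> {set {set V}}), #|V| = (s * n)%N ->
  kgraph_system k H ->
  (forall i, (deltaT R k x.1 x.2 + alpha) * 'C(s * n - x.1, k - x.1)%:R
             <= (min_degree x.1 (H i))%:R) ->
  has_transversal_factor x.2 n H.
have [|m0 m0P] := @fin_all_bound _ P.
  move=> [d F]; rewrite /P /=.
  have [Fk|nFk] := pselect (kgraph k F); last by exists 0%N.
  have [Ft|/eqP nFt] := eqVneq #|F| t; last by exists 0%N.
  have a2 : 0 < alpha / 2 by lra.
  (* Half of [alpha] pays for [delta] exceeding the infimum, the other half is the slack in the
     definition of the threshold. *)
  have F0 : (0 < #|F|)%N by rewrite Ft.
  have [delta thr lt] := threshold_near (ltn_ord d) Fk F0 a2.
  have [n0 n0P] := thr _ a2; exists n0 => n nn0 _ _ V H cV Hk degH.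
  move: n0P; rewrite Ft card_ord => /(_ n nn0 V H cV Hk); apply=> i.
  apply: le_trans (degH i); rewrite ler_wpM2r //; lra.
exists m0 => d dk VF F Fk VFs Ft J C V H mJ cC cV Hk degH.
have cVF : #|VF| = #|'I_s| by rewrite card_ord.
pose r : 'I_s -> VF := fun i => enum_val (cast_ord (esym (VFs)) i).
have r_bij : bijective r.
  apply: inj_card_bij; last by rewrite cVF.
  by move=> i i' /enum_val_inj /cast_ord_inj.
have [r' rK r'K] := r_bij; have r_inj := can_inj rK.
pose F0 := [set (r @^-1: (e : {set VF}))%SET | e : {set VF} in F].
have imgK (e : {set VF}) : (r @: (r @^-1: e))%SET = e.
  apply/setP => v; apply/imsetP/idP => [[w + ->]|ve]; first by rewrite inE.
  by exists (r' v); rewrite ?inE r'K.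
have pre_inj : injective (fun e : {set VF} => r @^-1: e)%SET.
  by move=> e e' ee'; rewrite -(imgK e) ee' imgK.
have F0t : #|F0| = t by rewrite card_imset.
have F0k : kgraph k F0.
  by move=> _ /imsetP[e eF ->]; rewrite -(card_imset _ r_inj) imgK Fk.
pose H' (i : 'I_(t * #|J|)) := H (enum_val (cast_ord (esym cC) i)).
have fac0 : has_transversal_factor F0 #|J| H'.
  apply: (m0P (Ordinal dk, F0) #|J| mJ) => //; first by move=> i; apply: Hk.
  by move=> i; rewrite /= (deltaT_transport R k d F r_bij); apply: degH.
have [phi [phi_bij [lam [lam_bij lamH]]]] : has_transversal_factor F #|J| H'.
  apply: (@transport_factor _ _ F0 F r') fac0; first by exists r.
    move=> e eF; apply/imsetP; exists e => //; apply/setP => v.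
    rewrite inE; apply/imsetP/idP => [[w we ->]|ve]; first by rewrite r'K.
    by exists (r v); rewrite ?rK.
  by rewrite F0t.
exists (fun q => phi (enum_rank q.1, q.2)); split.
  move=> [j v] [j' v'] /(bij_inj phi_bij) eqq.
  have /= /enum_rank_inj -> := congr1 fst eqq.
  by have /= -> := congr1 snd eqq.
exists (fun q => enum_val (cast_ord (esym cC) (lam (enum_rank q.1, q.2)))); split.
  move=> [j v] [j' v'] /enum_val_inj /cast_ord_inj /(bij_inj lam_bij) eqq.
  have /= /enum_rank_inj -> := congr1 fst eqq.
  by have /= -> := congr1 snd eqq.
by move=> j e; apply: lamH.
Qed.

(** * From good injections to embeddings *)

Section BlockEmbedding.
Variables (R : realType) (k d s t m0 n m : nat) (VF V J : finType).
Variables (F : {set {set VF}}) (H : 'I_m -> {set {set V}}) (b0 : 'I_n -> J).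
Variables (c0 a : R).

Let W : finType := ('I_n * (VF + edge_of F))%type.
Let cW (w : W) := is_inr w.2.
Let b (w : W) := b0 w.1.
Let cU := @is_inr V 'I_m.

Hypothesis VF_card : #|VF| = s.
Hypothesis F_card : #|F| = t.
Hypothesis H_card : kgraph_system k H.
Hypothesis fiber_ge : forall j, (m0 <= #|[set i | b0 i == j]|)%N.
Hypothesis fiber_d : (0 < m)%N -> forall j, (d <= s * #|[set i | b0 i == j]|)%N.
Hypothesis spans : forall (J' C' V' : finType) (H' : C' -> {set {set V'}}),
    (m0 <= #|J'|)%N -> #|C'| = (t * #|J'|)%N -> #|V'| = (s * #|J'|)%N ->
    (forall c, kgraph k (H' c)) ->
    (forall c, (c0 - a) * 'C(s * #|J'| - d, k - d)%:R <= (min_degree d (H' c))%:R) ->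
  embeds_factor J' F H'.

Lemma edge_of_card : #|edge_of F| = t.
Proof. by rewrite /edge_of card_sig -F_card. Qed.

Lemma card_pos (T : finType) (p : T -> VF + edge_of F) j : injective p ->
  #|[set w in block b j | w.2 \in codom p]| = (#|T| * #|[set i | b0 i == j]|)%N.
Proof.
move=> pI; rewrite mulnC -[#|T|]cardsT -cardsX.
rewrite -(@card_imset _ _ (fun q : 'I_n * T => (q.1, p q.2) : W)); last first.
  by move=> [i x] [i' x'] [-> /pI ->].
apply: eq_card => -[i u]; rewrite !inE /b /=.
apply/andP/imsetP => [[ij /codomP[x ->]]|[[i' x]]].
  by exists (i, x); rewrite // inE /= !inE ij.
by rewrite inE /= !inE andbT => ij [-> ->]; split=> //; apply: codom_f.
Qed.

Lemma vpos_card j : #|vpos cW b j| = (s * #|[set i | b0 i == j]|)%N.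
Proof.
rewrite -VF_card -(@card_pos _ inl) //; last by move=> ? ? [].
apply: eq_card => -[i [v|e]]; rewrite !inE /cW /=.
  by rewrite codom_f.
by rewrite andbF; apply/esym/negbTE; rewrite negb_and orbC; apply/orP; left;
   apply/codomP => -[].
Qed.

Lemma cpos_card j : #|[set w in block b j | cW w]| = (t * #|[set i | b0 i == j]|)%N.
Proof.
rewrite -edge_of_card -(@card_pos _ inr) //; last by move=> ? ? [].
apply: eq_card => -[i [v|e]]; rewrite !inE /cW /=.
  by rewrite andbF; apply/esym/negbTE; rewrite negb_and orbC; apply/orP; left;
     apply/codomP => -[].
by rewrite codom_f.
Qed.

Lemma block_card j : #|block b j| = ((s + t) * #|[set i | b0 i == j]|)%N.
Proof.
rewrite mulnDl -vpos_card -cpos_card -(cardsID [set w | cW w] (block b j)) addnC.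
by congr addn; apply: eq_card => w; rewrite !inE // andbC.
Qed.

(** The vertices and the colours in [T] form subtypes of the right sizes because [f] preserves
    sorts, and a block that is not bad satisfies the degree hypothesis of [spans] for the induced
    system. The factor found there stays inside [T], so blocks do not interfere. *)
Lemma block_embedding (f : {ffun W -> V + 'I_m}) j : f \in sinj cW cU ->
  ~~ bad_block cW b H d (k - d) c0 a j (f @: block b j) ->
  exists psi : {ffun W -> V + 'I_m}, [/\ {in block b j &, injective psi},
    forall w, w \in block b j -> psi w \in f @: block b j &
    forall i (e : edge_of F), b0 i == j ->
      [set psi (i, u) | u in inr e |: inl @: val e] \in system_hypergraph H].
Proof.
move=> /sinjP[fI fc] good; set T := f @: block b j in good *.
pose J' : finType := {i : 'I_n | b0 i == j}.
pose C' : finType := {c : 'I_m | inr c \in T}.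
pose V' : finType := {v : V | inl v \in T}.
pose H' (c : C') : {set {set V'}} := [set e | (val @: (e : {set V'})) \in H (val c)].
have J'c : #|J'| = #|[set i | b0 i == j]|.
  by rewrite card_sig; apply: eq_card => i; rewrite !inE.
have Timg (D : finType) (g : D -> V + 'I_m) (P : pred W) : injective g ->
    (forall w, P w = (f w \in codom g)) ->
    #|[pred x | g x \in T]| = #|[set w in block b j | P w]|.
  move=> gI gP; rewrite -(card_imset _ fI) -[LHS](card_imset _ gI).
  apply: eq_card => u; apply/imsetP/imsetP => [[x xT ->]|[w + ->]].
    have /imsetP[w wj xw] : g x \in T by exact: xT.
    by exists w; rewrite // inE wj gP -xw codom_f.
  rewrite inE gP => /andP[wj /codomP[x fx]]; exists x => //.
  by rewrite inE -fx imset_f.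
have V'c : #|V'| = (s * #|J'|)%N.
  rewrite card_sig J'c -vpos_card (Timg _ inl (fun w => ~~ cW w)) //; first by move=> ? ? [].
  move=> w; rewrite -fc; case: (f w) => [v|c] /=; first by rewrite codom_f.
  by apply/esym/negbTE/codomP => -[].
have C'c : #|C'| = (t * #|J'|)%N.
  rewrite card_sig J'c -cpos_card (Timg _ inr cW) //; first by move=> ? ? [].
  move=> w; rewrite -fc; case: (f w) => [v|c] /=; last by rewrite codom_f.
  by apply/esym/negbTE/codomP => -[].
have [phi [phiI [lam [lamI lamH]]]] : embeds_factor J' F H'.
  apply: spans => //; first by rewrite J'c.
    by move=> c e; rewrite inE => /H_card <-; rewrite card_imset //; apply: val_inj.
  move=> c; apply: min_degree_ge.
    by rewrite V'c J'c fiber_d //; apply: leq_ltn_trans (ltn_ord (val c)).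
  move=> D Dd; pose D1 : {set V} := [set val v | v in D].
  have D1d : #|D1| = d by rewrite card_imset //; apply: val_inj.
  have D1T : inl @: D1 \subset T.
    by apply/subsetP => _ /imsetP[_ /imsetP[v _ ->] ->]; apply: (valP v).
  move: good; rewrite negb_exists => /forallP/(_ (val c)).
  rewrite (valP c) /= negb_exists => /forallP/(_ D1).
  rewrite D1d eqxx D1T /= -leNgt /threshold vpos_card -J'c => le1.
  apply: (le_trans le1); rewrite ler_nat /degree.
  pose G (e : {set V}) : {set V'} := [set v | val v \in e].
  have GK (e : {set V}) : inl @: e \subset T -> val @: G e = e.
    move=> eT; apply/setP => v; apply/imsetP/idP => [[v' + ->]|ve].
      by rewrite inE.
    have vT : inl v \in T by apply: (subsetP eT); apply: imset_f.
    by exists (Sub v vT); rewrite ?inE SubK.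
  rewrite /deg_in -(@card_in_imset _ _ G).
    apply/subset_leq_card/subsetP => _ /imsetP[e + ->].
    rewrite inE => /and3P[eH De eT]; rewrite inE /= inE GK // eH /=.
    apply/subsetP => v vD; rewrite inE.
    have /(subsetP De) : (inl (val v) : V + 'I_m) \in inl @: D1 by do 2!apply: imset_f.
    by case/imsetP => v1 v1e eqv; move: v1e; rewrite -(inl_inj eqv).
  move=> e e'; rewrite !inE => /and3P[_ _ eT] /and3P[_ _ eT'] eqG.
  by rewrite -(GK e eT) eqG GK.
pose psi (w : W) : V + 'I_m := if insub w.1 is Some i' then
    match w.2 with inl v => inl (val (phi (i' : J', v)))
                 | inr e => inr (val (lam (i', e))) end else f w.
exists [ffun w => psi w]; split.
- move=> [i u] [i' u']; rewrite !inE /b /= => ij ij'; rewrite !ffunE /psi /=.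
  rewrite !insubT /=; case: u u' => [v|e] [v'|e'] // [] /val_inj.
    by move=> /phiI[-> ->].
  by move=> /lamI[-> ->].
- move=> [i u]; rewrite inE /b /= => ij; rewrite ffunE /psi /= insubT /=.
  by case: u => [v|e]; [apply: (valP (phi _)) | apply: (valP (lam _))].
- move=> i e ij; pose i' : J' := Sub i ij.
  have psiE u : [ffun w => psi w] (i, u) =
      match u with inl v => inl (val (phi (i', v)))
                 | inr e => inr (val (lam (i', e))) end.
    by rewrite ffunE /psi /= insubT.
  apply/imset2P; exists (val (lam (i', e))) [set val (phi (i', v)) | v in val e].
  + by [].
  + by have := lamH i' e; rewrite inE -imset_comp.
  + rewrite imsetU1 psiE; congr (_ |: _).
    by rewrite -!imset_comp; apply: eq_imset => v /=; rewrite psiE.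
Qed.

End BlockEmbedding.

(** * Choice of the parameters *)

Lemma bernoulli_sub (R : realDomainType) (x : R) r : 0 <= x <= 1 ->
  1 - r%:R * x <= (1 - x) ^+ r.
Proof.
move=> /andP[x0 x1]; elim: r => [|r IHr]; first by rewrite expr0 mul0r subr0.
rewrite exprS; have x1' : 0 <= 1 - x by rewrite subr_ge0.
apply: le_trans (ler_wpM2l x1' IHr).
have : 0 <= r%:R * x ^+ 2 by rewrite mulr_ge0 ?sqr_ge0.
by rewrite -natr1 expr2; lra.
Qed.

Lemma expr_sub_ge (R : realFieldType) (gamma : R) (N q r : nat) :
  (0 < N)%N -> (q <= N)%N -> r%:R * q%:R <= gamma * N%:R ->
  (1 - gamma) * N%:R ^+ r <= (N - q)%:R ^+ r.
Proof.
move=> N0 qN le_gamma; have N0R : 0 < N%:R :> R by rewrite ltr0n.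
have -> : (N - q)%:R = N%:R * (1 - q%:R / N%:R) :> R.
  by rewrite natrB // mulrBr mulr1 mulrC divfK ?gt_eqF.
rewrite exprMn mulrC ler_wpM2l ?exprn_ge0 //.
apply: le_trans (bernoulli_sub r _); last first.
  by rewrite divr_ge0 //= ler_pdivrMr // mul1r ler_nat.
by rewrite mulrA lerD2l lerN2 ler_pdivrMr.
Qed.

Lemma expR_dominates (R : realType) (b : R) (K1 p h0 : nat) : 0 < b ->
  exists h, [/\ (0 < h)%N, (h0 <= h)%N &
    8 * ((K1 * h.+1) ^ p)%N%:R <= expR (h%:R * b)].
Proof.
(* For [h >= A], the term of degree [p + 1] in the exponential series exceeds the polynomial;
   [h.+1 <= 2 * h] accounts for the 2 next to [K1]. *)
move=> b0; pose A := 8 * (2 * K1%:R) ^+ p * (p.+1)`!%:R / b ^+ p.+1.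
have A0 : 0 <= A.
  by rewrite divr_ge0 ?mulr_ge0 ?exprn_ge0 ?mulr_ge0 // ltW.
have := archi_boundP A0; set hA := Num.bound A => ltA.
exists (maxn 1 (maxn h0 hA)); set h := maxn _ _.
have h1 : (0 < h)%N by rewrite leq_max.
have hh0 : (h0 <= h)%N by rewrite !leq_max leqnn orbT.
have hhA : (hA <= h)%N by rewrite !leq_max leqnn !orbT.
split=> //.
have hb0 : 0 <= h%:R * b by rewrite mulr_ge0 // ltW.
have := expR_ge1Dxn p hb0; apply: le_trans.
apply: (@le_trans _ _ ((h%:R * b) ^+ p.+1 / (p.+1)`!%:R)); last by rewrite lerDr.
rewrite ler_pdivlMr ?ltr0n ?fact_gt0 //.
apply: (@le_trans _ _ (8 * (2 * K1%:R) ^+ p * h%:R ^+ p * (p.+1)`!%:R)).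
  rewrite ler_wpM2r // natrX -mulrA -exprMn ler_wpM2l //.
  apply: lerXn2r; rewrite ?nnegrE ?mulr_ge0 //.
  rewrite -!natrM ler_nat [(2 * K1)%N]mulnC -mulnA leq_mul2l; apply/orP; right.
  by rewrite mul2n -addnn -addn1 leq_add2l.
rewrite [(h%:R * b) ^+ _]exprMn [h%:R ^+ p.+1]exprS.
have Ah : A <= h%:R by apply: le_trans (ltW ltA) _; rewrite ler_nat.
move: Ah; rewrite /A ler_pdivrMr ?exprn_gt0 // => Ah.
have hp : 0 <= h%:R ^+ p :> R by rewrite exprn_ge0.
by have := ler_wpM2l hp Ah; lra.
Qed.

(** Consecutive intervals of length [m], the last one also absorbing the remainder, which is why the
    quotient is capped with [minn]. *)
Lemma blocks_exist m n : (0 < m <= n)%N ->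
  exists q (b0 : 'I_n -> 'I_q), forall j, (m <= #|[set i | b0 i == j]| <= 2 * m)%N.
Proof.
move=> /andP[m0 mn]; pose q := (n %/ m).-1.
have qE : q.+1 = (n %/ m)%N by rewrite prednK // divn_gt0.
have lt_q (i : nat) : (minn (i %/ m) q < q.+1)%N by rewrite ltnS geq_minr.
exists q.+1, (fun i : 'I_n => Ordinal (lt_q i)) => j.
have nm : (q.+1 * m <= n)%N by rewrite qE leq_trunc_div.
have nm2 : (n < q.+2 * m)%N by rewrite -addn1 qE addn1 ltn_ceil.
have jq : (j <= q)%N by rewrite -ltnS ltn_ord.
apply/andP; split.
  have lt_n (r : 'I_m) : (j * m + r < n)%N.
    apply: leq_trans nm; apply: (@leq_trans (j.+1 * m)).
      by rewrite mulSn addnC ltn_add2r.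
    by rewrite leq_mul2r ltnS jq orbT.
  rewrite -[m in (m <= _)%N]card_ord -(@card_imset _ _ (fun r => Ordinal (lt_n r))).
    apply/subset_leq_card/subsetP => _ /imsetP[r _ ->]; rewrite inE -val_eqE /=.
    by rewrite divnMDl // divn_small // addn0 (minn_idPl jq).
  by move=> r r' /(congr1 val) /= /addnI /val_inj.
have lo (i : 'I_n) : Ordinal (lt_q i) == j -> (j * m <= i < j * m + 2 * m)%N.
  move=> /eqP/(congr1 val) /= ij; apply/andP; split.
    by apply: leq_trans (leq_trunc_div i m); rewrite leq_mul2r -ij geq_minl orbT.
  rewrite -mulnDl addn2.
  have [lt_iq|le_qi] := ltnP (i %/ m) q.
    rewrite -ij (minn_idPl (ltnW lt_iq)); apply: (@leq_trans ((i %/ m).+1 * m)).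
      by rewrite ltn_ceil.
    by rewrite leq_mul2r leqnSn orbT.
  by rewrite -ij (minn_idPr le_qi); apply: ltn_trans nm2.
have sub_lt (i : 'I_n) : Ordinal (lt_q i) == j -> (i - j * m < 2 * m)%N.
  by move=> /lo /andP[jmi ilt]; rewrite ltn_subLR.
have m20 : (0 < 2 * m)%N by rewrite muln_gt0.
rewrite -[(2 * m)%N]card_ord.
rewrite -(@card_in_imset _ _ (fun i : 'I_n => insubd (Ordinal m20) (i - j * m)%N)).
  exact: max_card.
move=> i i'; rewrite !inE => ij ij' /(congr1 val); rewrite !val_insubd !sub_lt // => eqi.
apply: val_inj; have /andP[ji _] := lo i ij; have /andP[ji' _] := lo i' ij'.
by rewrite /= -(subnK ji) -(subnK ji') eqi.
Qed.

(** * From injections to a spread distribution *)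

Section SpreadFromInjections.
Variables (R : realType) (W U K J : finType) (cU : U -> K) (b : W -> J).
Variables (E : {set {set W}}) (E' : {set {set U}}) (G : {set {ffun W -> U}}).
Variables (n Q : nat) (C : R).

Hypothesis n_gt0 : (0 < n)%N.
Hypothesis G_gt0 : (0 < #|G|)%N.
Hypothesis G_sort : forall f w, f \in G -> (n <= sort_size cU (cU (f w)))%N.
Hypothesis G_ext : forall g : seq (W * U), uniq (unzip1 g) -> uniq (unzip2 g) ->
  (#|ext g :&: G| * ext_weight cU g)%N%:R <= 4 ^+ size g * #|G|%:R :> R.
Hypothesis G_emb : forall f, f \in G -> exists phi : {ffun W -> U},
  is_embedding E E' phi /\ forall w, phi w \in f @: block b (b w).
Hypothesis block_Q : forall j, (#|block b j| <= Q)%N.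
Hypothesis C_ge : 4 * expR 1 * Q%:R <= C.
Hypothesis C_le : C <= n%:R.

Let near (f : {ffun W -> U}) (phi : embedding E E') : bool :=
  [forall w, val phi w \in f @: block b (b w)].

Lemma G_near f : f \in G -> exists phi, near f phi.
Proof.
move=> /G_emb[phi [phiE phiN]]; exists (Sub phi phiE).
by apply/forallP => w; rewrite SubK.
Qed.

(** A non-empty left side forces [p] to be injective, since [y] is. Then [G_ext] costs [4 ^ r], and
    [ext_weight_ge] bounds the weight below by [(n / e) ^ r]. *)
Lemma ext_G_le (r : nat) (y : 'I_r -> U) (p : {ffun 'I_r -> W}) : injective y ->
  #|[set f in G | [forall i, f (p i) == y i]]|%:R * n%:R ^+ r
    <= (4 * expR 1) ^+ r * #|G|%:R :> R.
Proof.
move=> yI; set A := [set f in G | _].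
have C0 : 0 <= (4 * expR 1) ^+ r * #|G|%:R :> R.
  by rewrite mulr_ge0 ?exprn_ge0 ?mulr_ge0 ?expR_ge0.
have [->|/set0Pn[f0]] := eqVneq A set0; first by rewrite cards0 mul0r.
rewrite inE => /andP[f0G /forallP f0p].
pose g := [seq (p i, y i) | i <- enum 'I_r].
have szg : size g = r by rewrite size_map size_enum_ord.
have g1 : unzip1 g = [seq p i | i <- enum 'I_r] by rewrite /unzip1 -map_comp.
have g2 : unzip2 g = [seq y i | i <- enum 'I_r] by rewrite /unzip2 -map_comp.
have pI : injective p.
  by move=> i i' pii; apply: yI; rewrite -(eqP (f0p i)) -(eqP (f0p i')) pii.
have u1 : uniq (unzip1 g) by rewrite g1 map_inj_uniq ?enum_uniq.
have u2 : uniq (unzip2 g) by rewrite g2 map_inj_uniq ?enum_uniq.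
have AE : A = ext g :&: G.
  apply/setP => f; rewrite inE in_setI [RHS]andbC; congr (_ && _).
  rewrite inE; apply/idP/idP => [/forallP fp|/allP fg].
    by apply/allP => _ /mapP[i _ ->]; apply: fp.
  by apply/forallP => i; apply: (fg (p i, y i)); apply: map_f; rewrite mem_enum.
have ng : all (fun q => (n <= sort_size cU (cU q.2))%N) g.
  by apply/allP => _ /mapP[i _ ->] /=; rewrite -(eqP (f0p i)) G_sort.
have wg := ext_weight_ge R u2 ng; rewrite szg in wg.
have := G_ext u1 u2; rewrite szg -AE natrM => le1.
have e0 : 0 <= expR 1 ^+ r :> R by rewrite exprn_ge0 ?expR_ge0.
apply: (le_trans (ler_wpM2l (ler0n _ _) wg)).
by rewrite exprMn; have := ler_wpM2l e0 le1; lra.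
Qed.

(** [mu] is the law of an embedding chosen near a uniform [f] in [G]. If it sends [x i] to [y i],
    then [f] sends some [p i] in the block of [x i] to [y i]; there are at most [Q ^ r] such [p],
    each handled by [ext_G_le]. *)
Lemma spread_from_injections :
  exists mu : embedding E E' -> R, distribution mu /\ vertex_spread (C / n%:R) mu.
Proof.
have [f0 f0G] : exists f, f \in G by apply/card_gt0P.
have [phi0 _] := G_near f0G.
pose sel f := odflt phi0 [pick phi | near f phi].
have sel_near f : f \in G -> near f (sel f).
  move=> /G_near[phi nphi]; rewrite /sel; case: pickP => //= none.
  by rewrite none in nphi.
have GR : 0 < #|G|%:R :> R by rewrite ltr0n.
have nR : 0 < n%:R :> R by rewrite ltr0n.
have sum_sel (P : pred (embedding E E')) :
    (\sum_(phi | P phi) #|[set f in G | sel f == phi]| = #|[set f in G | P (sel f)]|)%N.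
  rewrite -[RHS]sum1_card (partition_big sel P) /=; last first.
    by move=> f; rewrite inE => /andP[].
  apply: eq_bigr => phi Pphi; rewrite -sum1_card; apply: eq_bigl => f.
  by rewrite !inE; case: eqP => [->|]; rewrite ?andbF ?Pphi ?andbT.
exists (fun phi => #|[set f in G | sel f == phi]|%:R / #|G|%:R); split.
  split=> [phi|]; first by rewrite divr_ge0.
  rewrite -mulr_suml -natr_sum (sum_sel predT) (_ : [set f in G | _] = G).
    by rewrite divff ?gt_eqF.
  by apply/setP => f; rewrite inE andbT.
have C0 : 0 <= C.
  by apply: le_trans C_ge; rewrite !mulr_ge0 ?expR_ge0.
split; first by rewrite divr_ge0 //= ler_pdivrMr // mul1r.
move=> r x y xI yI.
rewrite -mulr_suml -natr_sum (sum_sel (fun phi => [forall i, val phi (x i) == y i])).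
rewrite ler_pdivrMr // expr_div_n mulrAC ler_pdivlMr ?exprn_gt0 //.
pose ps := [set p : {ffun 'I_r -> W} in family (fun i => block b (b (x i)))].
have psQ : (#|ps| <= Q ^ r)%N.
  rewrite cardsE card_family -[r in (Q ^ r)%N]card_ord -prod_nat_const.
  rewrite foldrE big_map big_enum /=; apply: leq_prod => i _; exact: block_Q.
apply: (@le_trans _ _ (\sum_(p in ps)
    #|[set f in G | [forall i, f (p i) == y i]]|%:R * n%:R ^+ r)).
  rewrite -mulr_suml ler_wpM2r ?exprn_ge0 // -natr_sum ler_nat.
  apply: leq_trans (card_bigcup_le _ _); apply/subset_leq_card/subsetP => f.
  rewrite inE => /andP[fG /forallP selxy]; have /forallP nf := sel_near f fG.
  have ex i : exists w, (w \in block b (b (x i))) && (f w == y i).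
    have /imsetP[w wb fw] := nf (x i); exists w.
    by rewrite wb -fw (eqP (selxy i)) eqxx.
  pose p := [ffun i => xchoose (ex i)].
  have pP i : (p i \in block b (b (x i))) && (f (p i) == y i).
    by rewrite ffunE; apply: (xchooseP (ex i)).
  apply/bigcupP; exists p.
    by rewrite inE; apply/familyP => i; case/andP: (pP i).
  by rewrite inE fG /=; apply/forallP => i; case/andP: (pP i).
apply: (le_trans (ler_sum _ (fun p _ => ext_G_le p yI))).
rewrite sumr_const -[_ *+ _]mulr_natl mulrA ler_wpM2r //.
have e4 : 0 <= 4 * expR 1 :> R by rewrite mulr_ge0 ?expR_ge0.
apply: (@le_trans _ _ ((4 * expR 1 * Q%:R) ^+ r)).
  by rewrite [leRHS]exprMn mulrC ler_wpM2l ?exprn_ge0 // -natrX ler_nat.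
by apply: lerXn2r; rewrite ?nnegrE ?C_ge ?C0 // mulr_ge0.
Qed.

End SpreadFromInjections.

(** * Proof of the theorem *)

(** The case [t = 0], where [threshold_near] does not apply: there is nothing to colour and any
    bijection of the vertices will do. *)
Lemma embeds_edgeless (VF J C V : finType) (F : {set {set VF}}) (H : C -> {set {set V}}) :
  #|F| = 0%N -> #|V| = (#|VF| * #|J|)%N -> embeds_factor J F H.
Proof.
move=> F0 cV; have cJ : #|{: J * VF}| = #|V| by rewrite card_prod cV mulnC.
have noE (e : edge_of F) : False.
  by case: e => e eF; have := eF; rewrite (cards0_eq F0) inE.
exists (fun q => enum_val (cast_ord cJ (enum_rank q))); split.
  by move=> q q' /enum_val_inj /cast_ord_inj /enum_rank_inj.
exists (fun q => False_rect C (noE q.2)); split; first by move=> [j e]; case: (noE e).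
by move=> j e; case: (noE e).
Qed.

Section Assembly.
Variables (R : realType) (k d s t n m q Q h m0 : nat) (VF V : finType).
Variables (F : {set {set VF}}) (H : 'I_(t * n) -> {set {set V}}).
Variables (b0 : 'I_n -> 'I_q) (alpha beta C : R).

Let W : finType := ('I_n * (VF + edge_of F))%type.
Let cW (w : W) := is_inr w.2.
Let b (w : W) := b0 w.1.
Let cU := @is_inr V 'I_(t * n).
Let c0 := deltaT R k d F + alpha.
Let a := alpha / 2.
Let l := (k - d)%N.

Hypothesis VF_card : #|VF| = s.
Hypothesis F_card : #|F| = t.
Hypothesis V_card : #|V| = (s * n)%N.
Hypothesis F_k : kgraph k F.
Hypothesis H_k : kgraph_system k H.
Hypothesis d_bounds : (1 <= d < k)%N.
Hypothesis H_degree :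
  forall i, c0 * 'C(s * n - d, k - d)%:R <= (min_degree d (H i))%:R.
Hypothesis n_gt0 : (0 < n)%N.
Hypothesis m_h : m = (k * h.+1)%N.
Hypothesis m0_le : (m0 <= m)%N.
Hypothesis fiber : forall j, (m <= #|[set i | b0 i == j]| <= 2 * m)%N.
Hypothesis Q_def : Q = ((s + t) * (2 * m))%N.
Hypothesis spans : (0 < t)%N -> forall (J' C' V' : finType) (H' : C' -> {set {set V'}}),
    (m0 <= #|J'|)%N -> #|C'| = (t * #|J'|)%N -> #|V'| = (s * #|J'|)%N ->
    (forall c, kgraph k (H' c)) ->
    (forall c, (deltaT R k d F + alpha / 2) * 'C(s * #|J'| - d, k - d)%:R
               <= (min_degree d (H' c))%:R) ->
  embeds_factor J' F H'.
Hypothesis h_gt0 : (0 < h)%N.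
Hypothesis beta_gt0 : 0 < beta.
Hypothesis beta_half : 2 * beta <= 1.
Hypothesis beta_alpha : 10 * beta <= alpha.
Hypothesis beta_h : 1 <= beta * h%:R.
Hypothesis exp_large : 8 * (Q.+2 ^ k.+1)%N%:R <= expR (h%:R * beta ^+ 2).
Hypothesis n_large : (2 * (h * k) * (h * k + k.+2) <= n)%N.
Hypothesis n_k : (h * k + k.+2 < n)%N.
Hypothesis n_beta : k%:R * k%:R <= beta * n%:R.
Hypothesis C_ge : 4 * expR 1 * Q%:R <= C.
Hypothesis C_le : C <= n%:R.

Lemma sinj_gt0 : (0 < #|sinj cW cU|)%N.
Proof.
have c1 : #|{: 'I_n * VF}| = #|V|.
  by rewrite card_prod card_ord V_card VF_card mulnC.
have c2 : #|{: 'I_n * edge_of F}| = #|'I_(t * n)|.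
  by rewrite card_prod !card_ord (edge_of_card F_card) mulnC.
pose f (w : W) : V + 'I_(t * n) := match w.2 with
  | inl v => inl (enum_val (cast_ord c1 (enum_rank (w.1, v))))
  | inr e => inr (enum_val (cast_ord c2 (enum_rank (w.1, e)))) end.
apply/card_gt0P; exists [ffun w => f w]; apply/sinjP; split; last first.
  by move=> [i [v|e]]; rewrite ffunE.
move=> [i u] [i' u']; rewrite !ffunE /f /=.
by case: u u' => [v|e] [v'|e'] // [] /enum_val_inj /cast_ord_inj /enum_rank_inj [-> ->].
Qed.

Let bad := bad_block cW b H d l c0 a.
Let eps := zeta d h Q beta.

(** As [d < k], [Q.+2 * Q ^ d.+1] is at most [Q.+2 ^ k.+1]; the 2 in [zeta] against the 8 in
    [exp_large] leaves 1/4. *)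
Lemma eps_small : Q.+2%:R * eps <= 4^-1.
Proof.
have /andP[d1 dk] := d_bounds.
rewrite /eps /zeta expRN.
have e0 := expR_gt0 (h%:R * beta ^+ 2).
have -> : Q.+2%:R * ((Q ^ d.+1)%:R * (2 * (expR (h%:R * beta ^+ 2))^-1)) =
   (2 * (Q.+2 * Q ^ d.+1)%:R) / expR (h%:R * beta ^+ 2) :> R by rewrite natrM; ring.
rewrite ler_pdivrMr //.
have : (Q.+2 * Q ^ d.+1 <= Q.+2 ^ k.+1)%N.
  rewrite [leqRHS]expnS leq_mul2l; apply/orP; right.
  apply: (@leq_trans (Q.+2 ^ d.+1)); first by rewrite leq_exp2r // ltnW.
  by rewrite leq_pexp2l.
rewrite -(ler_nat R); move: exp_large; lra.
Qed.

Lemma block_Q j : (#|block b j| <= Q)%N.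
Proof.
rewrite (block_card b0 VF_card F_card) Q_def leq_mul2l.
by have /andP[_ ->] := fiber j; rewrite orbT.
Qed.

(** In [m = k * h.+1], one [k] absorbs the [d] removed positions and [k * h] remain; by [beta_h],
    [beta * (k * h)] is at least [k], hence at least [l]. *)
Lemma vpos_large_enough j : (0 < t)%N ->
  l%:R <= beta * (#|vpos cW b j| - d)%:R /\ (h * l + d.+1 <= #|vpos cW b j|)%N.
Proof.
move=> t0; have /andP[d1 dk] := d_bounds.
have s0 : (0 < s)%N.
  have /card_gt0P[e eF] : (0 < #|F|)%N by rewrite F_card.
  by rewrite -VF_card (leq_trans _ (max_card (mem e))) // (F_k eF) (leq_ltn_trans _ dk).
have vm : (m <= #|vpos cW b j|)%N.
  rewrite (vpos_card F b0 VF_card); apply: (@leq_trans #|[set i | b0 i == j]|).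
    by have /andP[] := fiber j.
  by rewrite leq_pmull.
have kh : (k * h <= #|vpos cW b j| - d)%N.
  rewrite leq_subRL; last first.
    by apply: leq_trans vm; rewrite m_h (leq_trans (ltnW dk)) // leq_pmulr.
  by apply: leq_trans vm; rewrite m_h mulnS leq_add2r ltnW.
split.
  apply: (@le_trans _ _ (beta * (k * h)%:R)).
    rewrite natrM mulrCA; apply: (@le_trans _ _ k%:R).
      by rewrite ler_nat leq_subr.
    by rewrite -[leLHS]mulr1 ler_wpM2l.
  by rewrite ler_wpM2l ?ler_nat // ltW.
apply: leq_trans vm; rewrite m_h mulnS addnC leq_add //.
by rewrite mulnC leq_mul2r leq_subr orbT.
Qed.

Lemma bad_bounds :
  (forall j, #|[set f in sinj cW cU | bad j (f @: block b j)]|%:R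
     <= eps * #|sinj cW cU|%:R) /\
  (forall u, \sum_j #|[set f in sinj cW cU |
      bad j (f @: block b j) && (u \in f @: block b j)]|%:R
     <= eps * #|sinj cW cU|%:R).
Proof.
have eps0 : 0 <= eps by rewrite !mulr_ge0 ?expR_ge0.
have [t0|t_gt0] := posnP t.
  have nobad j T : bad j T = false.
    apply/negbTE/negP => /existsP[i _].
    by have := leq_ltn_trans (leq0n i) (ltn_ord i); rewrite t0.
  have E0 : 0 <= eps * #|sinj cW cU|%:R by rewrite mulr_ge0.
  have none (P : pred {ffun W -> V + 'I_(t * n)}) j :
      #|[set f in sinj cW cU | bad j (f @: block b j) && P f]| = 0%N.
    by apply/eqP; rewrite cards_eq0; apply/eqP/setP => f; rewrite !inE nobad andbF.
  split=> [j|u]; apply: le_trans E0.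
    rewrite lern0 -leqn0 -[leqRHS](none predT j); apply/subset_leq_card/subsetP => f.
    by rewrite !inE andbT.
  by rewrite big1 // => j _; rewrite none.
have /andP[d1 dk] := d_bounds.
have kE : (d + l)%N = k by rewrite subnKC // ltnW.
have lk : (l <= k)%N by rewrite leq_subr.
have s0 : (0 < s)%N.
  have /card_gt0P[e eF] : (0 < #|F|)%N by rewrite F_card.
  by rewrite -VF_card (leq_trans _ (max_card (mem e))) // (F_k eF) (leq_ltn_trans _ dk).
have nV : (n <= #|V|)%N by rewrite V_card leq_pmull.
have V0 : (0 < #|V|)%N by apply: leq_trans nV.
pose q1 := (h * l + d.+2)%N; pose D0 := (#|V| - q1)%N.
have q1k : (q1 <= h * k + k.+2)%N.
  by apply: leq_add; [rewrite leq_mul2l lk orbT | rewrite !ltnS ltnW].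
have q1V : (q1 < #|V|)%N by apply: leq_ltn_trans q1k _; apply: leq_trans nV.
have H_card i : kgraph (d + l) (H i) by rewrite kE; apply: H_k.
have H_deg i (D : {set V}) : #|D| = d -> c0 * 'C(#|V| - d, l)%:R <= (degree (H i) D)%:R.
  move=> Dd; apply: (le_trans (_ : _ <= (min_degree d (H i))%:R)).
    by rewrite V_card; apply: H_degree.
  by rewrite ler_nat min_degree_le.
have D0_gt0 : (0 < D0)%N by rewrite subn_gt0.
have D0_le : (D0 + h * l + d.+2 <= #|V|)%N by rewrite -addnA subnK // ltnW.
have D0_N : #|V|%:R ^+ (h * l) <= 2 * D0%:R ^+ (h * l) :> R.
  (* Bernoulli's inequality: by [n_large], [h * l * q1] is at most half of [#|V|]. *)
  have : (1 - 2^-1) * #|V|%:R ^+ (h * l) <= D0%:R ^+ (h * l) :> R.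
    apply: expr_sub_ge; rewrite ?(ltnW q1V) //.
    rewrite -natrM mulrC ler_pdivlMr ?ltr0n // -natrM ler_nat mulnC.
    apply: leq_trans nV; apply: leq_trans n_large.
    by rewrite mulnA leq_mul // leq_mul2l leq_mul2l lk !orbT.
  lra.
have N_ffact : (1 - beta) * #|V|%:R ^+ l <= ((#|V| - d) ^_ l)%:R :> R.
  have dlV : (d + l <= #|V|)%N.
    rewrite kE; apply: leq_trans nV; apply: leq_trans (ltnW n_k).
    by rewrite -addn2 addnCA leq_addr.
  apply: (@le_trans _ _ ((#|V| - (d + l))%:R ^+ l)).
    apply: expr_sub_ge => //; rewrite kE; apply: (@le_trans _ _ (k%:R * k%:R)).
      by rewrite ler_wpM2r // ler_nat.
    by apply: (le_trans n_beta); rewrite ler_wpM2l ?ler_nat // ltW.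
  rewrite -natrX ler_nat subnDA.
  elim: (l) (#|V| - d)%N => [|r IHr] N; first by rewrite expn0 ffactn0.
  rewrite ffactnS expnS; apply: leq_mul; first exact: leq_subr.
  by apply: leq_trans (IHr N.-1); rewrite -subn1 -subnDA add1n.
have beta_a : 5 * beta <= a by rewrite /a; move: beta_alpha; lra.
have large j (w : W) : w \in block b j -> cW w ->
  l%:R <= beta * (#|vpos cW b j| - d)%:R /\ (h * l + d.+1 <= #|vpos cW b j|)%N.
  by move=> _ _; apply: vpos_large_enough.
split=> [j|u].
  exact: (bad_block_prob H_card H_deg h_gt0 D0_gt0 D0_le D0_N beta_gt0 beta_half
    beta_a N_ffact block_Q large).
exact: (bad_vertex_prob H_card H_deg h_gt0 D0_gt0 D0_le D0_N beta_gt0 beta_half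
    beta_a N_ffact block_Q large).
Qed.

Lemma assembled_spread :
  exists mu : embedding (factor n (expansion F)) (system_hypergraph H) -> R,
    distribution mu /\ vertex_spread (C / n%:R) mu.
Proof.
have /andP[d1 dk] := d_bounds; have [badJ badU] := bad_bounds.
pose G := good_sinj cW cU b bad.
have G_gt0 : (0 < #|G|)%N := good_sinj_gt0 block_Q eps_small badJ badU sinj_gt0.
have G_sinj f : f \in G -> f \in sinj cW cU by rewrite inE => /andP[].
apply: (@spread_from_injections _ _ _ _ _ cU b _ _ G n Q) => //.
- move=> f [i u] /G_sinj /sinjP[fI fc].
  (* Varying the copy index in [(i', u)] yields [n] distinct values of the sort of [f (i, u)]. *)
  rewrite -[n in (n <= _)%N]card_ord -(@card_imset _ _ (fun i' => f (i', u))); last first.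
    by move=> i1 i2 /fI [].
  apply/subset_leq_card/subsetP => _ /imsetP[i' _ ->].
  by rewrite inE !fc.
- move=> g ug _; exact: (good_sinj_ext block_Q eps_small badJ badU sinj_gt0).
- move=> f fG; have fO := G_sinj f fG.
  have good j : ~~ bad j (f @: block b j).
    by move: fG; rewrite inE => /andP[_ /forallP].
  have fiber_ge j : (m0 <= #|[set i | b0 i == j]|)%N.
    by apply: leq_trans m0_le _; have /andP[] := fiber j.
  have c0a : c0 - a = deltaT R k d F + alpha / 2 by rewrite /c0 /a; lra.
  have fiber_d : (0 < t * n)%N -> forall j, (d <= s * #|[set i | b0 i == j]|)%N.
    rewrite muln_gt0 => /andP[t0 _] j; rewrite -(vpos_card F b0 VF_card).
    have [_] := vpos_large_enough j t0; apply: leq_trans.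
    by rewrite (leq_trans (leqnSn d)) ?leq_addl.
  have spans' : forall (J' C' V' : finType) (H' : C' -> {set {set V'}}),
      (m0 <= #|J'|)%N -> #|C'| = (t * #|J'|)%N -> #|V'| = (s * #|J'|)%N ->
      (forall c, kgraph k (H' c)) ->
      (forall c, (c0 - a) * 'C(s * #|J'| - d, k - d)%:R <= (min_degree d (H' c))%:R) ->
    embeds_factor J' F H'.
    rewrite c0a; have [t0|/spans//] := posnP t.
    move=> J' C' V' H' _ _ cV' _ _; apply: embeds_edgeless; first by rewrite F_card.
    by rewrite VF_card.
  have /fin_all_exists[psi psiP] j :=
    block_embedding VF_card F_card H_k fiber_ge fiber_d spans' fO (good j).
  have psi_in w : psi (b w) w \in f @: block b (b w).
    by have [_ + _] := psiP (b w); apply; rewrite inE.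
  have /sinjP[fI _] := fO.
  exists [ffun w => psi (b w) w]; split; last by move=> w; rewrite ffunE.
  apply/andP; split.
    apply/injectiveP => w w'; rewrite !ffunE => eqp.
    (* A common value of two blocks would lie in both of their images under [f], against
       injectivity. *)
    have bb : b w = b w'.
      have := psi_in w; rewrite eqp => /imsetP[w1 w1b fw1].
      have := psi_in w'; rewrite fw1 => /imsetP[w2 w2b /fI w12].
      move: w1b w2b; rewrite w12 !inE => /eqP <- /eqP.
      by [].
    have [inj _ _] := psiP (b w'); apply: inj.
    - by rewrite inE; apply/eqP.
    - by rewrite inE.
    - by move: eqp; rewrite bb.
  apply/forall_inP => _ /imset2P[i e _ + ->] => /imsetP[e0 _ ->].
  have [_ _ /(_ i e0 (eqxx _)) edge] := psiP (b0 i).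
  suff -> : [ffun w => psi (b w) w] @: [set (i, u) | u in inr e0 |: inl @: val e0]
      = [set psi (b0 i) (i, u) | u in inr e0 |: inl @: val e0] by [].
  by rewrite -imset_comp; apply: eq_imset => u /=; rewrite ffunE.
- exact: block_Q.
Qed.

End Assembly.

Theorem theorem2p10 (R : realType) (alpha : R) (k s t : nat) :
  0 < alpha ->
  exists C : R, 0 < C /\
  forall d : nat, (1 <= d <= k - 1)%N ->
  exists n0 : nat, forall n : nat, (n0 <= n)%N ->
  forall (VF : finType) (F : {set {set VF}}),
    kgraph k F -> #|VF| = s -> #|F| = t ->
  forall (V : finType) (H : 'I_(t * n) -> {set {set V}}),
    kgraph_system k H -> #|V| = (s * n)%N ->
    (forall i, (deltaT R k d F + alpha) * 'C(s * n - d, k - d)%:R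
               <= (min_degree d (H i))%:R) ->
  exists mu : embedding (factor n (expansion F)) (system_hypergraph H) -> R,
    distribution mu /\ vertex_spread (C / n%:R) mu.
Proof.
move=> alpha0.
have alpha2 : 0 < alpha / 2 by lra.
have [m0 spans] : exists m0, (0 < t)%N -> forall d, (d < k)%N ->
  forall (VF : finType) (F : {set {set VF}}),
    kgraph k F -> #|VF| = s -> #|F| = t ->
  forall (J C V : finType) (H : C -> {set {set V}}),
    (m0 <= #|J|)%N -> #|C| = (t * #|J|)%N -> #|V| = (s * #|J|)%N ->
    (forall c, kgraph k (H c)) ->
    (forall c, (deltaT R k d F + alpha / 2) * 'C(s * #|J| - d, k - d)%:R
               <= (min_degree d (H c))%:R) ->
  embeds_factor J F H.
  have [->|t0] := posnP t; first by exists 0%N.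
  by have [m0 m0P] := uniform_threshold k s alpha2 t0; exists m0.
(* [10 * beta <= alpha] makes the loss [5 * beta] inside a block at most [alpha / 2]; the minimum
   with 1 ensures [2 * beta <= 1]. *)
pose beta : R := Num.min alpha 1 / 10.
have beta0 : 0 < beta by rewrite divr_gt0 // lt_min alpha0 ltr01.
have [beta_alpha beta1] : 10 * beta <= alpha /\ 10 * beta <= 1.
  have /andP[h1 h2] : (Num.min alpha 1 <= alpha) && (Num.min alpha 1 <= 1).
    by rewrite !ge_min !lexx orbT.
  by rewrite /beta; split; lra.
have beta2 : 0 < beta ^+ 2 by rewrite exprn_gt0.
(* [h] is chosen before [d], hence the exponent [k.+1]. The base bounds [Q.+2], and the lower bound
   on [h] gives [m0 <= m] and [1 <= beta * h]. *)
have [h [h_gt0 h_ge exp_large]] := expR_dominates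
  ((s + t) * 2 * k + 2) k.+1 (maxn m0 (Num.bound beta^-1)) beta2.
pose m := (k * h.+1)%N; pose Q := ((s + t) * (2 * m))%N.
(* The added 1 keeps the constant positive even if [Q] is 0. *)
exists (4 * expR 1 * Q%:R + 1); split.
  by rewrite ltr_wpDl // !mulr_ge0 ?expR_ge0.
move=> d /andP[d1 dk1].
have dk : (d < k)%N by lia.
have k0 : (0 < k)%N by lia.
exists (maxn (maxn m (Num.bound (4 * expR 1 * Q%:R + 1 : R)))
  (maxn (maxn (2 * (h * k) * (h * k + k.+2)) (h * k + k.+2).+1)
     (Num.bound (k%:R * k%:R / beta)))) => n.
rewrite !geq_max => /andP[/andP[mn Cn] /andP[/andP[n_large n_k] nb]].
move=> VF F Fk VFs Ft V H Hk cV degH.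
have m_gt0 : (0 < m)%N by rewrite muln_gt0 k0.
have [|q [b0 fiber]] := @blocks_exist m n; first by rewrite m_gt0.
move: h_ge; rewrite geq_max => /andP[m0h hb].
have bound_le (x : R) N : 0 <= x -> (Num.bound x <= N)%N -> x <= N%:R.
  by move=> x0 le_N; apply: (le_trans (ltW (archi_boundP x0))); rewrite ler_nat.
apply: (@assembled_spread R k d s t n m q Q h m0 VF V F H b0 alpha beta) => //.
- by rewrite d1.
- exact: leq_trans m_gt0 mn.
- by apply: leq_trans m0h _; rewrite /m; apply: leq_trans (leqnSn h) _; rewrite leq_pmull.
- by move=> t0; apply: spans.
- lra.
- rewrite mulrC -ler_pdivrMr // div1r; apply: bound_le => //.
  by rewrite invr_ge0 ltW.
- apply: le_trans exp_large; rewrite ler_wpM2l // ler_nat leq_exp2r //.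
  by rewrite /Q /m; lia.
- rewrite [leRHS]mulrC -ler_pdivrMr //; apply: bound_le => //.
  by apply: divr_ge0; [apply: mulr_ge0 | apply: ltW].
- by rewrite lerDl.
- by apply: bound_le => //; rewrite addr_ge0 // !mulr_ge0 ?expR_ge0.
Qed.
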